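(* Let $\mathcal L_\theta$ be a difference-differential parameter operator with shifts $V=\{v_1,\ldots,v_J\}$ on an open set $U\subseteq\Theta^\circ$, and let the kernel $f$ satisfy the associated shift parameter PDE on $U$, i.e. $\mathcal L_\theta f(x\mid\theta)=0$ for $\lambda$-almost every $x\in\mathcal X$ and every $\theta\in U$. Let $B=B(\theta_0,\rho)\subseteq U$ be an open ball such that $\overline{B+v_j}\subset\Theta^\circ$ for all $j=1,\ldots,J$ and whose radius satisfies $\rho<\frac12\min_{i\ne j}\|v_i-v_j\|$. Suppose that $\mathcal L_\theta$ is non-trivial on $B$. If the Borel probability measure $G_*$ on $\Theta$ admits a density $g_*$ with respect to the Lebesgue measure on $\Theta$ satisfying $g_*\ge m$ Lebesgue-almost everywhere on $\bigcup_{j=1}^J(B+v_j)$, for some $m>0$, then there exists a Borel probability measure $G$ on $\Theta$ with $G\ne G_*$ such that $p_G=p_{G_*}$ $\lambda$-almost everywhere.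
   Context: Standing setting. The sample space $\mathcal X$ is a Borel subset of $\mathbb R^{d_1}$ with a $\sigma$-finite Borel measure $\lambda$ (understood to be Lebesgue measure for continuous kernels and counting measure for discrete ones). The parameter space $\Theta\subset\mathbb R^{d_2}$ is compact and equal to the closure of its interior $\Theta^\circ$, which is non-empty; $\Theta$ carries the restriction of Lebesgue measure. A kernel is a jointly measurable function $f:\mathcal X\times\Theta\to[0,\infty)$, written $f(x\mid\theta)$, with $\int_{\mathcal X}f(x\mid\theta)\,\lambda(dx)=1$ for every $\theta\in\Theta$. For a Borel probability measure $G$ on $\Theta$, $p_G(x):=\int_\Theta f(x\mid\theta)\,G(d\theta)$. $B(\theta_0,\rho)$ is the open Euclidean ball of centre $\theta_0$ and radius $\rho$. For a multi-index $\alpha\in\mathbb N_0^{d_2}$, $|\alpha|=\alpha_1+\cdots+\alpha_{d_2}$ and $\partial_\theta^\alpha=\partial^{|\alpha|}/\partial\theta_1^{\alpha_1}\cdots\partial\theta_{d_2}^{\alpha_{d_2}}$ (the identity when $|\alpha|=0$). Difference-differential parameter operator. Let $V=\{v_1,\ldots,v_J\}\subset\mathbb R^{d_2}$ be a finite set of distinct vectors with $v_1=0$, let $r_1,\ldots,r_J\in\mathbb N_0$, and let $U\subseteq\Theta^\circ$ be open with $U+v_j\subseteq\Theta^\circ$ for all $j$. A difference-differential parameter operator $\mathcal L_\theta$ with shifts $V$ on $U$ acts on functions $w\in C^{\max_j r_j}\big(\bigcup_j(U+v_j)\big)$ by $$\mathcal L_\theta w=\sum_{j=1}^J\sum_{|\alpha|\le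 r_j}c_{j,\alpha}(\theta)\,(\partial_\theta^\alpha w)(\theta+v_j),\qquad\theta\in U,$$ with coefficients $c_{j,\alpha}\in C^{|\alpha|}(U)$. It is non-trivial on a set $A\subseteq U$ if $c_{j,\alpha}$ is not identically zero on $A$ for at least one pair $(j,\alpha)$. When $\mathcal L_\theta$ is applied to $f$, it acts on $\theta\mapsto f(x\mid\theta)$, which is understood to belong to $C^{\max_j r_j}\big(\bigcup_j(U+v_j)\big)$ for $\lambda$-almost every $x$. *)

(* Defs.v *)
From HB Require Import structures.
From mathcomp Require Import all_boot all_order all_algebra.
From mathcomp Require Import all_classical all_reals all_analysis.

Set Implicit Arguments.
Unset Strict Implicit.
Unset Printing Implicit Defensive.

Import Order.TTheory GRing.Theory Num.Theory.
Import numFieldNormedType.Exports.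

Local Open Scope classical_set_scope.
Local Open Scope ring_scope.

(* 'M[R]_(m, n), hence 'rV[R]_d, carries its Borel sigma-algebra, generated by
   the open sets of the library's topology (entrywise convergence) *)
HB.instance Definition _ (R : realType) (m n : nat) :=
  @isMeasurable.Build (sigma_display (@open 'M[R]_(m, n))) 'M[R]_(m, n)
    <<s @open 'M[R]_(m, n) >>
    (@sigma_algebra0 _ setT (@open 'M[R]_(m, n)))
    (@sigma_algebraC 'M[R]_(m, n) (@open 'M[R]_(m, n)))
    (@sigma_algebra_bigcup _ setT (@open 'M[R]_(m, n))).

Lemma measurable_coord (R : realType) (m n : nat) (i : 'I_m) (j : 'I_n) :
  measurable_fun [set: 'M[R]_(m, n)] (fun M => M i j : R).
Proof.
apply: (measurability _ (measurable_realfun.RGenOpens.measurableE R)).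
move=> _ [_ [a [b ->] <-]]; rewrite setTI.
apply: sub_sigma_algebra => /=.
by apply: open_comp => [x _|]; [exact: coord_continuous|exact: interval_open].
Qed.

Lemma measurable_rV (R : realType) d (T : measurableType d) (n : nat)
    (f : T -> 'rV[R]_n) :
  (forall j, measurable_fun setT (fun t => f t 0 j)) -> measurable_fun setT f.
Proof.
move=> mf; apply: (@measurability _ _ _ _ _ _ (@open 'rV[R]_n)) => //.
move=> _ [A oA <-]; rewrite setTI.
pose box (p : {ffun 'I_n -> rat * rat}) :=
  [set t | forall j, f t 0 j \in `]ratr (p j).1, ratr (p j).2[ ].
pose good (p : {ffun _ -> rat * rat}) := [set x : 'rV[R]_n |
  forall j, x 0 j \in `]ratr (p j).1, ratr (p j).2[ ] `<=` A.
have -> : f @^-1` A = \bigcup_(p in [set p | good p]) box p.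
  apply/seteqP; split => [t Oft|t [p gp bp]]; last exact: gp.
  have [e /= e0 eO] : nbhs_ball (f t) A.
    by apply/nbhs_ballP; apply: open_nbhs_nbhs; split.
  have ex j : {q : rat * rat |
      [/\ f t 0 j - e < ratr q.1, ratr q.1 < f t 0 j,
          f t 0 j < ratr q.2 & ratr q.2 < f t 0 j + e]}.
    apply: cid.
    have [|a /andP[a1 a2]] := @rat_in_itvoo R (f t 0 j - e) (f t 0 j).
      by rewrite ltrBlDr ltrDl.
    have [|b /andP[b1 b2]] := @rat_in_itvoo R (f t 0 j) (f t 0 j + e).
      by rewrite ltrDl.
    by exists (a, b); split.
  exists [ffun j => sval (ex j)] => /=.
    move=> x xb; apply: eO; split => // i j; rewrite (ord1 i).
    have := xb j; rewrite ffunE in_itv/=; case: (ex j) => q [/= q1 q2 q3 q4].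
    move=> /andP[qx xq]; rewrite /ball/= distrC ltr_distl.
    by rewrite (lt_trans q1 qx)/= (lt_trans xq q4).
  move=> j; rewrite ffunE in_itv/=; case: (ex j) => q [/= q1 q2 q3 q4].
  by rewrite q2 q3.
rewrite bigcup_mkcond; apply: countable_bigcupT_measurable => // p.
case: ifPn => // _.
rewrite (_ : box p = \bigcap_(j in [set: 'I_n])
    ((fun t => f t 0 j) @^-1` `]ratr (p j).1 : R, ratr (p j).2[%classic)).
  apply: fin_bigcap_measurable => // j _.
  by rewrite -[X in measurable X]setTI; exact: mf.
by apply/seteqP; split => [t bt j _|t bt j]; [exact: bt|exact: (bt j)].
Qed.

Section lebesgue_rV.
Variable R : realType.

Definition cons_rV n (p : measurableTypeR R * 'rV[R]_n) : 'rV[R]_(1 + n) :=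
  row_mx (p.1%:M : 'rV[R]_1) p.2.

Lemma measurable_cons_rV n : measurable_fun setT (@cons_rV n).
Proof.
apply: measurable_rV => j; case: (split_ordP j) => k jk.
  rewrite (_ : (fun t => _) = fst); first exact: measurable_fst.
  by apply/funext => t; rewrite jk /cons_rV row_mxEl mxE (ord1 k) eqxx.
rewrite (_ : (fun t => _) = (fun M : 'rV[R]_n => M 0 k) \o snd).
  exact: (measurableT_comp (measurable_coord _ _) measurable_snd).
by apply/funext => t; rewrite jk /cons_rV row_mxEr.
Qed.

Lemma cons_rV0 n p : (@cons_rV n p : 'rV[R]_n.+1) 0 ord0 = p.1.
Proof.
rewrite (_ : ord0 = lshift n (0 : 'I_1)); last exact/val_inj.
by rewrite [LHS]row_mxEl mxE eqxx mulr1n.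
Qed.

Lemma cons_rVS n p i : (@cons_rV n p : 'rV[R]_n.+1) 0 (lift ord0 i) = p.2 0 i.
Proof.
rewrite (_ : lift ord0 i = rshift 1 i); last exact/val_inj.
exact: row_mxEr.
Qed.

Definition lebesgue_cons n (mu : {sigma_finite_measure set 'rV[R]_n -> \bar R})
    : set 'rV[R]_(1 + n) -> \bar R :=
  pushforward (lebesgue_measure \x mu)%E (@cons_rV n).

Section lebesgue_cons_measure.
Variables (n : nat) (mu : {sigma_finite_measure set 'rV[R]_n -> \bar R}).

HB.instance Definition _ := Measure.copy (lebesgue_cons mu)
  (measure_function_pushforward__canonical__measure_function_Measure
     _ (@measurable_cons_rV n)).

Let sigma_finite_lebesgue_cons : sigma_finite setT (lebesgue_cons mu).
Proof.
have /sigma_finiteP[F [FT ndF Ffin]] := sigma_finiteT (@lebesgue_measure R).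
have /sigma_finiteP[G [GT ndG Gfin]] := sigma_finiteT mu.
pose h (x : 'rV[R]_(1 + n)) : measurableTypeR R := x 0 (lshift n 0).
pose t (x : 'rV[R]_(1 + n)) : 'rV[R]_n := rsubmx x.
have mh : measurable_fun setT h by exact: measurable_coord.
have mt : measurable_fun setT t.
  apply: measurable_rV => j.
  by under eq_fun do rewrite mxE; exact: measurable_coord.
exists (fun k => h @^-1` F k `&` t @^-1` G k).
  apply/esym; rewrite -subTset => x _.
  have [i _ Fi] : (\bigcup_i F i) (h x) by rewrite -FT.
  have [j _ Gj] : (\bigcup_j G j) (t x) by rewrite -GT.
  exists (maxn i j) => //; split.
  - by have /subsetPset := ndF _ _ (leq_maxl i j); exact.
  - by have /subsetPset := ndG _ _ (leq_maxr i j); exact.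
move=> k; have [mF Fk] := Ffin k; have [mG Gk] := Gfin k; split.
  apply: measurableI; rewrite -[X in measurable X]setTI; first exact: mh.
  exact: mt.
rewrite /lebesgue_cons /pushforward (_ : _ @^-1` _ = F k `*` G k).
  by rewrite product_measure1E// lte_mul_pinfty// ge0_fin_numE.
apply/seteqP; split => -[a y] /=;
  by rewrite /h /t /cons_rV row_mxEl mxE eqxx mulr1n row_mxKr.
Qed.

HB.instance Definition _ := Measure_isSigmaFinite.Build _ _ _
  (lebesgue_cons mu) sigma_finite_lebesgue_cons.

End lebesgue_cons_measure.

(* 'rV[R]_0 is a point, of mass 1; then 'rV[R]_n.+1 = R * 'rV[R]_n *)
Fixpoint lebesgue_rV n : {sigma_finite_measure set 'rV[R]_n -> \bar R} :=
  if n is n'.+1 then lebesgue_cons (lebesgue_rV n') else \d_(0 : 'rV[R]_0).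

Lemma lebesgue_rV_box n (E : 'I_n -> set (measurableTypeR R)) :
  (forall i, measurable (E i)) ->
  lebesgue_rV n [set x | forall i, E i (x 0 i)] =
  (\prod_(i < n) lebesgue_measure (E i))%E.
Proof.
elim: n E => [|n IH] E mE.
  by rewrite big_ord0 /= diracE mem_set//= => i; have := ltn_ord i.
have mB : measurable [set x : 'rV[R]_n | forall i, E (lift ord0 i) (x 0 i)].
  rewrite (_ : mkset _ = \bigcap_(i in [set: 'I_n])
     ((fun x : 'rV[R]_n => x 0 i) @^-1` E (lift ord0 i))).
    apply: fin_bigcap_measurable => // i _.
    rewrite -[X in measurable X]setTI.
    by apply: (measurable_coord 0 i) => //; exact: mE.
  by apply/seteqP; split => [x bx i _|x bx i]; [exact: bx|exact: (bx i)].
rewrite big_ord_recl -IH// -product_measure1E//=.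
rewrite /lebesgue_cons /pushforward; congr (product_measure1 _ _ _).
apply/seteqP; split => -[a y].
  move=> /= H; split; first by have := H ord0; rewrite cons_rV0.
  by move=> i; have := H (lift ord0 i); rewrite cons_rVS.
move=> /= -[Ea Ey] i; case: (unliftP ord0 i) => [k|] ->.
  by rewrite cons_rVS; exact: Ey.
by rewrite cons_rV0.
Qed.

End lebesgue_rV.

Section euclidean.
Variables (R : realType) (d : nat).
Implicit Types (x c v : 'rV[R]_d) (A : set 'rV[R]_d).

(* the library's norm on 'rV[R]_d is the sup norm *)
Definition enorm x : R := Num.sqrt (\sum_i x 0 i ^+ 2).

Definition eball c (r : R) : set 'rV[R]_d := [set x | enorm (x - c) < r].

Definition translate A v : set 'rV[R]_d := [set x + v | x in A].

End euclidean.

Section multi_index.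
Variables (R : realType) (d : nat).
Implicit Types (a : 'I_d -> nat) (w : 'rV[R]_d -> R) (W : set 'rV[R]_d).

Definition mdegree a : nat := (\sum_i a i)%N.

Definition partial (i : 'I_d) w : 'rV[R]_d -> R := 'D_(delta_mx 0 i) w.

Definition mpartial a w : 'rV[R]_d -> R :=
  foldr (fun i => iter (a i) (partial i)) w (enum 'I_d).

(* Intended for open W: the values of w outside W are then irrelevant. *)
Fixpoint Ck (k : nat) W w : Prop :=
  (forall x, W x -> {for x, continuous w}) /\
  (if k is k'.+1 then
     forall i : 'I_d, (forall x, W x -> derivable w x (delta_mx 0 i)) /\
                      Ck k' W (partial i w)
   else True).

End multi_index.

(* There are nshift.+1 shifts, so that v_1 is [shift_vec L ord0]; the
   coefficients of index (j, a) with |a| > order L j are never used. *)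
Record ddop (R : realType) (d : nat) := DDOp {
  nshift : nat ;
  shift_vec : 'I_nshift.+1 -> 'rV[R]_d ;
  order : 'I_nshift.+1 -> nat ;
  coeff : 'I_nshift.+1 -> ('I_d -> nat) -> 'rV[R]_d -> R }.
Arguments shift_vec {R d} _ _.
Arguments order {R d} _ _.
Arguments coeff {R d} _ _ _ _.

Section difference_differential.
Variables (R : realType) (d : nat).
Implicit Types (L : ddop R d) (Theta U A : set 'rV[R]_d).

Definition shifted_union L A : set 'rV[R]_d :=
  \bigcup_j translate A (shift_vec L j).

Definition max_order L : nat := (\max_(j < (nshift L).+1) order L j)%N.

Definition is_ddop Theta U L : Prop :=
  [/\ injective (shift_vec L) /\ shift_vec L ord0 = 0,
      open U /\ U `<=` Theta°,
      forall j, translate U (shift_vec L j) `<=` Theta° &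
      forall (j : 'I_(nshift L).+1) (a : 'I_d -> nat),
        (mdegree a <= order L j)%N -> Ck (mdegree a) U (coeff L j a)].

(* |a| <= order L j forces every entry of a to be at most order L j, which makes
   the range of the inner sum a finite type. *)
Definition ddop_apply L (w : 'rV[R]_d -> R) (theta : 'rV[R]_d) : R :=
  \sum_(j < (nshift L).+1)
    \sum_(a : {ffun 'I_d -> 'I_(order L j).+1} |
          (mdegree (fun i => a i : nat) <= order L j)%N)
      coeff L j (fun i => a i : nat) theta *
      mpartial (fun i => a i : nat) w (theta + shift_vec L j).

Definition nontrivial_on A L : Prop :=
  exists (j : 'I_(nshift L).+1) (a : 'I_d -> nat),
    (mdegree a <= order L j)%N /\ exists2 theta, A theta & coeff L j a theta != 0.

End difference_differential.

Section mixtures.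
Variables (R : realType) (d1 d2 : nat).
Variables (X : set 'rV[R]_d1) (lambda : {measure set 'rV[R]_d1 -> \bar R}).
Variable Theta : set 'rV[R]_d2.
Implicit Types (f : 'rV[R]_d1 -> 'rV[R]_d2 -> R).
Local Open Scope ereal_scope.

Definition is_kernel f : Prop :=
  [/\ measurable_fun (X `*` Theta)
        (fun p : 'rV[R]_d1 * 'rV[R]_d2 => f p.1 p.2),
      forall x theta, X x -> Theta theta -> (0 <= f x theta)%R &
      forall theta, Theta theta -> \int[lambda]_(x in X) (f x theta)%:E = 1].

(* the lambda-null set of exceptional x does not depend on theta *)
Definition shift_parameter_pde (U : set 'rV[R]_d2) (L : ddop R d2) f : Prop :=
  {ae lambda, forall x, X x ->
    Ck (max_order L) (shifted_union L U) (f x) /\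
    forall theta, U theta -> ddop_apply L (f x) theta = 0%R}.

(* A Borel probability measure on Theta is represented by one on 'rV[R]_d2
   giving mass 1 to Theta. *)
Definition prob_on (G : probability 'rV[R]_d2 R) : Prop := G Theta = 1.

Definition mixture f (G : probability 'rV[R]_d2 R) (x : 'rV[R]_d1) : \bar R :=
  \int[G]_(theta in Theta) (f x theta)%:E.

Definition is_density (G : probability 'rV[R]_d2 R) (g : 'rV[R]_d2 -> R) :=
  [/\ measurable_fun Theta g,
      forall theta, Theta theta -> (0 <= g theta)%R &
      forall A, measurable A -> A `<=` Theta ->
        G A = \int[lebesgue_rV R d2]_(theta in A) (g theta)%:E].

End mixtures.

(* Main.v *)
Require Import Defs.
From HB Require Import structures.
From mathcomp Require Import all_boot all_order all_algebra.
From mathcomp Require Import all_classical all_reals all_analysis.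
From mathcomp Require Import measurable_realfun ring lra.

Set Implicit Arguments.
Unset Strict Implicit.
Unset Printing Implicit Defensive.

Import Order.TTheory GRing.Theory Num.Theory.
Import numFieldNormedType.Exports.

Local Open Scope classical_set_scope.
Local Open Scope ring_scope.

(** The mixing measure is perturbed along a function [h] on the parameter space
that is orthogonal to every [f x]; such an [h] is obtained by letting the formal
adjoint of the operator act on a bump function.

Let [phi] be a C^k function with compact support in the ball [B], and let
[adjoint L phi] be the function obtained by moving [L] from [w] to [phi] in the
integral of [phi * L w]: each term [c * (D^a w) (t + v)] is first translated by
the shift [v] and then integrated by parts [|a|] times.  Hence the integral of
[adjoint L phi * w] equals that of [phi * L w] for all [w] smooth enough on the
shifted balls ([adjoint_duality]).  With [w := f x] the right-hand side is zero
by the shift parameter PDE, so [h := adjoint L phi] is orthogonal to almost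
every [f x].  Integrating this over [x] and exchanging the integrals
([integral_mixture_kernel]), where each [f _ t] has total mass 1, shows that
[h] itself has integral zero.

For a suitable [phi], [h] does not vanish ([exists_nonzero_adjoint]).  Pick
a coefficient [c_(j,a)] that is nonzero at a point [t1] of [B].  The radius
condition makes the shifted balls disjoint, so there is a smooth [w] equal to
the monomial [(t - t1 - v_j)^a] on the [j]-th shifted ball and to 0 on the
others; then [L w] is [a! * c_(j,a)] at [t1], hence nonzero.  Taking for [phi]
a bump so concentrated at [t1] that [L w] keeps its sign on the support makes
the integral of [phi * L w] nonzero, and by duality [h] is nonzero.

Finally [h] is continuous with compact support inside the shifted balls, where
the density [gstar] is at least [m].  So [gstar + e * h] is nonnegative for
small [e], has mass 1, yields the same mixture for almost every [x], and
differs from [gstar] on the open set where [h] has the sign it takes at some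
point ([perturbed_mixture]).

Integration by parts rests on the translation invariance of Lebesgue measure:
the difference quotients of a compactly supported [u] have integral zero, and
dominated convergence carries this over to the partial derivative
([Rint_partial]). *)

(** * Borel sets and translations of row vectors *)

Section measurability.
Variables (R : realType) (n : nat).

Lemma measurable_open (A : set 'rV[R]_n) : open A -> measurable A.
Proof. exact: sub_sigma_algebra. Qed.

Lemma measurable_closed (A : set 'rV[R]_n) : closed A -> measurable A.
Proof.
by move=> /closed_openC/measurable_open/measurableC; rewrite setCK.
Qed.

Lemma continuous_measurable (u : 'rV[R]_n -> R) :
  continuous u -> measurable_fun setT u.
Proof.
move=> cu; apply: (measurability _ (measurable_realfun.RGenOpens.measurableE R)).
move=> _ [_ [a [b ->] <-]]; rewrite setTI.
apply: measurable_open; apply: open_comp => [x _|]; first exact: cu.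
exact: interval_open.
Qed.

Lemma measurable_shift (v : 'rV[R]_n) :
  measurable_fun setT (fun x : 'rV[R]_n => x + v).
Proof.
apply: measurable_rV => j; under eq_fun do rewrite mxE.
by apply: measurable_funD => //; exact: measurable_coord.
Qed.

End measurability.

Section translation.
Variable R : realType.

Lemma lebesgue_measure_shift (c : R) (A : set (measurableTypeR R)) :
  measurable A -> lebesgue_measure ((fun x : R => x + c) @^-1` A) =
                  lebesgue_measure A.
Proof.
move=> mA.
have ms : measurable_fun setT ((fun x : R => x + c) :
    measurableTypeR R -> measurableTypeR R).
  exact: measurable_funD.
apply/esym.
apply: (@lebesgue_measure_unique R
  (measure_function_pushforward__canonical__measure_function_Measure
     lebesgue_measure ms)) => //= _ [[a b]] _ <-.
rewrite /pushforward (_ : _ @^-1` _ = `](a - c), (b - c)]%classic).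
  by rewrite !lebesgue_measure_itv/= !lte_fin ltrD2r -!EFinB opprB addrA subrK.
by apply/seteqP; split => x /=; rewrite !in_itv/= ltrBlDr lerBrDr.
Qed.

Lemma cons_rV_shift n (p : measurableTypeR R * 'rV[R]_n) (v : 'rV[R]_n.+1) :
  (cons_rV p : 'rV_n.+1) + v =
  cons_rV ((p.1 : R) + v 0 ord0, p.2 + \row_i v 0 (lift ord0 i)).
Proof.
apply/rowP => i; case: (unliftP ord0 i) => [k|] ->; rewrite mxE.
  by rewrite !cons_rVS !mxE.
by rewrite !cons_rV0.
Qed.

(** Lebesgue measure on row vectors is built one coordinate at a time, so
uniqueness of product measures reduces this to dimension one. *)
Lemma lebesgue_rV_shift n (v : 'rV[R]_n) (A : set 'rV[R]_n) : measurable A ->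
  lebesgue_rV R n ((fun x => x + v) @^-1` A) = lebesgue_rV R n A.
Proof.
elim: n v A => [|n IH] v A mA.
  by congr (_ _); apply/seteqP; split => x /=; rewrite (_ : x + v = x)//;
     apply/rowP => -[].
pose v0 := (v : 'rV_n.+1) 0 ord0.
pose v' : 'rV[R]_n := \row_i (v : 'rV_n.+1) 0 (lift ord0 i).
pose s (p : measurableTypeR R * 'rV[R]_n) : measurableTypeR R * 'rV[R]_n :=
  (p.1 + v0 : R, p.2 + v').
have ms : measurable_fun setT s.
  apply/measurable_fun_pairP; split => /=.
    by apply: measurable_funD => //; exact: measurable_fst.
  exact: (measurableT_comp (@measurable_shift _ _ _) measurable_snd).
have mC : measurable (@cons_rV R n @^-1` A).
  by rewrite -[X in measurable X]setTI; exact: measurable_cons_rV.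
rewrite /= /lebesgue_cons /pushforward.
transitivity ((lebesgue_measure \x lebesgue_rV R n)%E
   (s @^-1` (@cons_rV R n @^-1` A))).
  congr (_ _); apply/seteqP; split => p; rewrite /= /preimage /=;
  by rewrite cons_rV_shift.
apply/esym; apply: (@product_measure_unique _ _ _ _ _ lebesgue_measure
  (lebesgue_rV R n)
  (measure_function_pushforward__canonical__measure_function_Measure
     (lebesgue_measure \x lebesgue_rV R n)%E ms)) => // B C mB mC'.
rewrite /= /pushforward (_ : s @^-1` _ =
  ((fun x : R => x + v0) @^-1` B) `*` ((fun y => y + v') @^-1` C))//.
rewrite product_measure1E//.
- by congr (_ * _)%E; [exact: lebesgue_measure_shift|exact: IH].
- have mv : measurable_fun setT ((fun x : R => x + v0) :
      measurableTypeR R -> measurableTypeR R) by exact: measurable_funD.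
  by rewrite -[X in measurable X]setTI; exact: mv.
- by rewrite -[X in measurable X]setTI; exact: measurable_shift.
Qed.

End translation.

(** * Integrals of continuous functions with compact support *)

Section compact_support.
Variables (R : realType) (n : nat).
Implicit Types (u w : 'rV[R]_n -> R) (K : set 'rV[R]_n).
Local Notation mu := (lebesgue_rV R n).

Lemma normr_coord_le (x : 'rV[R]_n) i : `|x 0 i| <= `|x|.
Proof.
rewrite [leRHS]/Num.Def.normr/= mx_normrE.
by apply/bigmax_geP; right => /=; exists (0, i).
Qed.

Lemma rV_compact_closed K : compact K -> closed K.
Proof. by apply: compact_closed; exact: norm_hausdorff. Qed.

Lemma measurable_compact K : compact K -> measurable K.
Proof. by move=> /rV_compact_closed/measurable_closed. Qed.

(** A compact set lies in a cube, whose volume is an explicit product. *)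
Lemma compact_lebesgue_lty K : compact K -> (mu K < +oo)%E.
Proof.
move=> cK; have mK := measurable_compact cK.
have /compact_bounded[M [_ MK]] := cK.
have {}MK := MK (`|M| + 1) _; set N := `|M| + 1 in MK.
pose Q := [set x : 'rV[R]_n | forall i, (fun=> `[- N, N]%classic) i (x 0 i)].
have KQ : K `<=` Q.
  move=> x /MK xM i /=; rewrite in_itv/= -ler_norml.
  apply: le_trans (normr_coord_le _ _) (xM _).
  by rewrite (le_lt_trans (ler_norm _))// ltrDl.
have mQ : measurable Q.
  rewrite (_ : Q = \bigcap_(i in [set: 'I_n])
     ((fun x : 'rV[R]_n => x 0 i) @^-1` `[- N, N]%classic)).
    apply: fin_bigcap_measurable => // i _.
    by rewrite -[X in measurable X]setTI; exact: measurable_coord.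
  by apply/seteqP; split => [x bx i _|x bx i]; [exact: bx|exact: (bx i)].
apply: (@le_lt_trans _ _ (mu Q)); first by rewrite le_measure ?inE.
rewrite lebesgue_rV_box//.
elim/big_rec: _ => [|i x _ xoo]; first exact: ltry.
by apply: lte_mul_pinfty => //; rewrite lebesgue_measure_itv/= ?lte_fin;
  case: ifP => // _; rewrite -EFinB ltry.
Qed.

Lemma bounded_csupp_integrable u K (C : R) : measurable_fun setT u ->
  compact K -> (forall x, `|u x| <= C) -> (forall x, ~ K x -> u x = 0) ->
  mu.-integrable setT (EFin \o u).
Proof.
move=> mmu cK uC uK; have mK := measurable_compact cK.
apply: (@le_integrable _ _ _ mu _ measurableT _ (fun x => (C * \1_K x)%:E)).
- exact/measurable_EFinP.
- move=> x _ /=; rewrite lee_fin indicE.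
  have [Kx|Kx] := pselect (K x).
    by rewrite mem_set// mulr1 (le_trans (uC x))// ler_norm.
  by rewrite uK// normr0.
have iK : mu.-integrable setT (fun x => (\1_K x)%:E).
  apply/integrableP; split; first exact/measurable_EFinP.
  under eq_integral do rewrite gee0_abs ?lee_fin//.
  by rewrite integral_indic// setIT; exact: compact_lebesgue_lty.
have := integrableZl measurableT C iK.
by apply: eq_integrable => // x _; rewrite EFinM.
Qed.

Definition Cc u := continuous u /\
  exists2 K, compact K & forall x, ~ K x -> u x = 0.

Lemma Cc_bounded u : Cc u -> exists C, forall x, `|u x| <= C.
Proof.
move=> [cu [K cK uK]].
have /compact_bounded[M [_ MK]] : compact (u @` K).
  by apply: continuous_compact => //; exact: continuous_subspaceT.
exists (`|M| + 1) => x; have [Kx|Kx] := pselect (K x).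
  apply: MK; last by exists x.
  by rewrite (le_lt_trans (ler_norm _))// ltrDl.
by rewrite uK// normr0 addr_ge0.
Qed.

Lemma Cc_integrable u : Cc u -> mu.-integrable setT (EFin \o u).
Proof.
move=> cu; have [C uC] := Cc_bounded cu.
case: cu => cu [K cK uK].
exact: bounded_csupp_integrable (continuous_measurable cu) cK uC uK.
Qed.

Lemma Cc0 : Cc (fun=> 0).
Proof.
split; first exact: cst_continuous.
by exists set0 => //; exact: compact0.
Qed.

Lemma CcD u w : Cc u -> Cc w -> Cc (fun x => u x + w x).
Proof.
move=> [cu [K cK uK]] [cw [K' cK' wK']]; split.
  by move=> x; apply: continuousD; [exact: cu|exact: cw].
exists (K `|` K'); first exact: compactU.
move=> x Kx; rewrite uK ?wK' ?addr0// => ?; apply: Kx; [by right|by left].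
Qed.

Lemma CcMl u w : continuous u -> Cc w -> Cc (fun x => u x * w x).
Proof.
move=> cu [cw [K cK wK]]; split.
  by move=> x; apply: continuousM; [exact: cu|exact: cw].
by exists K => // x Kx; rewrite wK// mulr0.
Qed.

Lemma CcZ (a : R) u : Cc u -> Cc (fun x => a * u x).
Proof. by apply: CcMl; exact: cst_continuous. Qed.

Lemma Cc_sum (I : Type) (s : seq I) (P : pred I) (u : I -> 'rV[R]_n -> R) :
  (forall i, P i -> Cc (u i)) -> Cc (fun x => \sum_(i <- s | P i) u i x).
Proof.
move=> cu; elim: s => [|i s IH].
  by under eq_fun do rewrite big_nil; exact: Cc0.
under eq_fun do rewrite big_cons; case: (boolP (P i)) => // Pi.
by apply: CcD => //; exact: cu.
Qed.

Lemma Rint_sum (I : Type) (s : seq I) (P : pred I) (u : I -> 'rV[R]_n -> R) :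
  (forall i, P i -> Cc (u i)) ->
  \int[mu]_x (\sum_(i <- s | P i) u i x) = \sum_(i <- s | P i) \int[mu]_x u i x.
Proof.
move=> cu; elim: s => [|i s IH].
  rewrite big_nil /Rintegral -[RHS]/(fine 0%E) -(@integral0 _ _ _ mu setT).
  congr fine; apply: eq_integral => x _.
  by rewrite big_nil.
transitivity (\int[mu]_x (if P i then u i x + \sum_(j <- s | P j) u j x
                          else \sum_(j <- s | P j) u j x)).
  by apply: eq_Rintegral => x _; rewrite big_cons.
rewrite big_cons; case: (boolP (P i)) => // Pi.
rewrite RintegralD ?IH//; first by apply: Cc_integrable; exact: cu.
by apply: Cc_integrable; exact: Cc_sum.
Qed.

Lemma continuous_shiftD (v : 'rV[R]_n) :
  continuous (fun x : 'rV[R]_n => x + v).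
Proof. by move=> x; apply: continuousD; [exact: cvg_id|exact: cst_continuous]. Qed.

Lemma Cc_shift u (v : 'rV[R]_n) : Cc u -> Cc (fun x => u (x + v)).
Proof.
move=> [cu [K cK uK]]; split.
  by move=> x; apply: continuous_comp; [exact: continuous_shiftD|exact: cu].
exists ((fun x => x - v) @` K).
  by apply: continuous_compact => //; apply: continuous_subspaceT;
    exact: continuous_shiftD.
by move=> x Kx; apply: uK => Kxv; apply: Kx; exists (x + v) => //; rewrite addrK.
Qed.

Lemma Rint_shift u (v : 'rV[R]_n) : Cc u ->
  \int[mu]_x u (x + v) = \int[mu]_x u x.
Proof.
move=> cu; rewrite /Rintegral; congr fine.
have cuv := Cc_integrable (Cc_shift v cu).
have mEu : measurable_fun setT (EFin \o u).
  by apply/measurable_EFinP; exact: continuous_measurable cu.1.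
transitivity (\int[pushforward mu (fun x => x + v)%R]_x (u x)%:E)%E.
  exact: (esym (integral_pushforward (measurable_shift v) mEu cuv measurableT)).
apply: eq_measure_integral => [|mv A mA _]; first exact: measurable_shift.
exact: lebesgue_rV_shift.
Qed.

(** By continuity [u] is at least [u c / 2] on a cube around [c], and cubes have
positive volume. *)
Lemma Rint_gt0 u c : Cc u -> (forall x, 0 <= u x) -> 0 < u c ->
  0 < \int[mu]_x u x.
Proof.
move=> cu u0 uc.
have /cvgrPdist_lt /(_ (u c / 2)) := cu.1 c.
rewrite divr_gt0// => /(_ isT) /nbhs_ballP[e /= e0 eu].
pose Q := [set x : 'rV[R]_n |
  forall i, (fun i => `]c 0 i - e, c 0 i + e[%classic) i (x 0 i)].
have mQ : measurable Q.
  rewrite (_ : Q = \bigcap_(i in [set: 'I_n])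
     ((fun x : 'rV[R]_n => x 0 i) @^-1` `]c 0 i - e, c 0 i + e[%classic)).
    apply: fin_bigcap_measurable => // i _.
    by rewrite -[X in measurable X]setTI; exact: measurable_coord.
  by apply/seteqP; split => [x bx i _|x bx i]; [exact: bx|exact: (bx i)].
have muQ : (0 < mu Q)%E.
  rewrite lebesgue_rV_box//; elim/big_rec: _ => [|i x _ x0].
    by rewrite lte_fin.
  rewrite mule_gt0// lebesgue_measure_itv/= lte_fin ifT; last by lra.
  by rewrite -EFinB lte_fin; lra.
have uQ x : Q x -> u c / 2 <= u x.
  move=> Qx; have : `|u c - u x| < u c / 2.
    apply: eu; split => // i j; rewrite (ord1 i) /ball/= distrC ltr_distl.
    by have := Qx j; rewrite /= in_itv.
  rewrite ltr_norml => /andP[_]; lra.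
have iu := Cc_integrable cu.
rewrite -lte_fin /Rintegral fineK; last exact: integrable_fin_num.
apply: (@lt_le_trans _ _ (\int[mu]_(x in Q) (u c / 2)%:E)%E).
  rewrite integral_cst//.
  by apply: mule_gt0 => //; rewrite lte_fin divr_gt0.
apply: (@le_trans _ _ (\int[mu]_(x in Q) (u x)%:E)%E).
  apply: ge0_le_integral => //.
  - by move=> x _; rewrite lee_fin divr_ge0// ltW.
  - apply/measurable_EFinP/measurable_funTS.
    exact: continuous_measurable cu.1.
apply: ge0_subset_integral => //.
- by apply/measurable_EFinP; exact: continuous_measurable cu.1.
- by move=> x _; rewrite lee_fin.
Qed.

End compact_support.

(** * Calculus of C^k functions *)

Section directional_derivatives.
Variables (R : realType) (n : nat).
Implicit Types (u w : 'rV[R]_n -> R) (x y : 'rV[R]_n) (K U W : set 'rV[R]_n).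
Local Notation mu := (lebesgue_rV R n).

(** Reduces directional derivatives to one-variable calculus on a line. *)
Lemma is_derive_line u (x v : 'rV[R]_n) (s : R) : derivable u (s *: v + x) v ->
  is_derive s (1 : R) (fun t : R => u (t *: v + x)) ('D_v u (s *: v + x)).
Proof.
move=> du; have E : (fun h : R => h^-1 *:
    (((fun t : R => u (t *: v + x)) \o shift s) (h *: 1) - u (s *: v + x))) =
  (fun h => h^-1 *: ((u \o shift (s *: v + x)) (h *: v) - u (s *: v + x))).
  apply/funext => h /=; congr (_ *: (u _ - _)).
  by rewrite [h *: 1]mulr1 scalerDl addrA.
by split; rewrite /derivable /derive E.
Qed.

Lemma partial_local u w W i x : open W -> (forall y, W y -> u y = w y) -> W x ->
  partial i u x = partial i w x.
Proof.
move=> oW uw Wx; apply: near_eq_derive; near=> y; apply: uw.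
by near: y; exact: open_nbhs_nbhs.
Unshelve. all: by end_near. Qed.

Lemma derivable_local u w W (v x : 'rV[R]_n) : open W ->
  (forall y, W y -> u y = w y) -> W x -> derivable u x v -> derivable w x v.
Proof.
move=> oW uw Wx; apply: near_eq_derivable; near=> y; apply: uw.
by near: y; exact: open_nbhs_nbhs.
Unshelve. all: by end_near. Qed.

Lemma continuous_local u w W x : open W ->
  (forall y, W y -> u y = w y) -> W x -> {for x, continuous u} ->
  {for x, continuous w}.
Proof.
move=> oW uw Wx cu; rewrite /prop_for /continuous_at -uw//.
have nW : nbhs x W by exact: open_nbhs_nbhs.
have wu : {near x, u =1 w} by apply: filterS nW => y /uw.
exact: cvg_trans (near_eq_cvg wu) cu.
Qed.

Lemma partial_shift u (v : 'rV[R]_n) i :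
  partial i (fun x => u (x + v)) = fun x => partial i u (x + v).
Proof.
apply/funext => x; rewrite /partial /derive.
set f := fun h => _; set g := fun h => _.
by rewrite (_ : f = g)//; apply/funext => h; rewrite /f /g /= addrA.
Qed.

Lemma derivable_shift u (v x e : 'rV[R]_n) : derivable u (x + v) e ->
  derivable (fun x => u (x + v)) x e.
Proof.
rewrite /derivable; set f := fun h => _; set g := fun h => _.
by rewrite (_ : g = f)//; apply/funext => h; rewrite /f /g /= addrA.
Qed.

Lemma Ck_cont k W w x : Ck k W w -> W x -> {for x, continuous w}.
Proof. by case: k => [|k] [+ _]; apply. Qed.

(** [Ck] only sees the values on the open set, although the derivatives it
mentions are those of the total functions. *)
Lemma Ck_eq k W u w : open W -> (forall x, W x -> u x = w x) ->
  Ck k W u -> Ck k W w.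
Proof.
move=> oW; elim: k u w => [|k IH] u w uw [cu du]; split => //.
- by move=> x Wx; exact: (continuous_local oW uw Wx (cu _ Wx)).
- by move=> x Wx; exact: (continuous_local oW uw Wx (cu _ Wx)).
- move=> i; have [di Ci] := du i; split.
    by move=> x Wx; exact: (derivable_local oW uw Wx (di _ Wx)).
  by apply: IH Ci => x Wx; exact: partial_local uw Wx.
Qed.

Lemma Ck_sub k U W w : U `<=` W -> Ck k W w -> Ck k U w.
Proof.
move=> UW; elim: k w => [|k IH] w [cw dw]; split => //.
- by move=> x /UW; exact: cw.
- by move=> x /UW; exact: cw.
- by move=> i; have [di Ci] := dw i; split; [move=> x /UW; exact: di|exact: IH].
Qed.

Lemma CkS k W w : Ck k.+1 W w -> Ck k W w.
Proof.
elim: k w => [|k IH] w [cw dw]; split => // i.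
by have [di Ci] := dw i; split => //; exact: IH.
Qed.

Lemma Ck_le k l W w : (k <= l)%N -> Ck l W w -> Ck k W w.
Proof.
elim: l => [|l IH]; first by rewrite leqn0 => /eqP ->.
by rewrite leq_eqVlt => /orP[/eqP -> //|kl /CkS]; exact: IH.
Qed.

Lemma Ck_bigcup (I : Type) k (W : I -> set 'rV[R]_n) w :
  (forall i, Ck k (W i) w) -> Ck k (\bigcup_i W i) w.
Proof.
elim: k w => [|k IH] w Cw; split => //.
- by move=> x [i _ Wx]; exact: Ck_cont (Cw i) Wx.
- by move=> x [i _ Wx]; exact: Ck_cont (Cw i) Wx.
- move=> i; split; last by apply: IH => j; exact: ((Cw j).2 i).2.
  by move=> x [j _ Wx]; exact: ((Cw j).2 i).1.
Qed.

Lemma CkD k W u w : open W -> Ck k W u -> Ck k W w ->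
  Ck k W (fun x => u x + w x).
Proof.
move=> oW; elim: k u w => [|k IH] u w [cu du] [cw dw]; split => //.
- by move=> x Wx; apply: continuousD; [exact: cu|exact: cw].
- by move=> x Wx; apply: continuousD; [exact: cu|exact: cw].
- move=> i; have [di Ci] := du i; have [di' Ci'] := dw i; split.
    by move=> x Wx; apply: derivableD; [exact: di|exact: di'].
  apply: Ck_eq (IH _ _ Ci Ci') => // x Wx.
  by rewrite /partial [RHS]deriveD//; [exact: di|exact: di'].
Qed.

Lemma CkM k W u w : open W -> Ck k W u -> Ck k W w ->
  Ck k W (fun x => u x * w x).
Proof.
move=> oW; elim: k u w => [|k IH] u w Cu Cw; split => //.
- by move=> x Wx; apply: continuousM; [exact: Ck_cont Cu Wx|exact: Ck_cont Cw Wx].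
- by move=> x Wx; apply: continuousM; [exact: Ck_cont Cu Wx|exact: Ck_cont Cw Wx].
- move=> i; have [di Ci] := Cu.2 i; have [di' Ci'] := Cw.2 i; split.
    by move=> x Wx; apply: derivableM; [exact: di|exact: di'].
  apply: Ck_eq (CkD oW (IH _ _ (CkS Cu) Ci') (IH _ _ (CkS Cw) Ci)) => // x Wx.
  by rewrite /partial [RHS]deriveM//; [exact: di|exact: di'].
Qed.

Lemma partial_cst (i : 'I_n) (c : R) : partial i (fun=> c) = fun=> 0.
Proof. by apply/funext => x; exact: derive_cst. Qed.

Lemma Ck_cst k W (c : R) : Ck k W (fun=> c).
Proof.
elim: k c => [|k IH] c; split => //.
- by move=> x _; exact: cst_continuous.
- by move=> x _; exact: cst_continuous.
- by move=> i; split; [move=> x _; exact: derivable_cst|rewrite partial_cst].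
Qed.

Lemma Ck_shift k W u (v : 'rV[R]_n) : Ck k W u ->
  Ck k ((fun x => x + v) @^-1` W) (fun x => u (x + v)).
Proof.
have H w (x : 'rV[R]_n) : {for x + v, continuous w} ->
    {for x, continuous (fun x => w (x + v))}.
  move=> cw; exact: (continuous_comp (@continuous_shiftD R n v x) cw).
elim: k u => [|k IH] u [cu du]; split => //.
- by move=> x Wx; apply: H; exact: cu.
- by move=> x Wx; apply: H; exact: cu.
- move=> i; have [di Ci] := du i; split.
    by move=> x Wx; apply: derivable_shift; exact: di.
  by rewrite partial_shift; exact: IH.
Qed.

Lemma partial_off K u i x : closed K -> (forall x, ~ K x -> u x = 0) ->
  ~ K x -> partial i u x = 0.
Proof.
move=> cK uK Kx; transitivity (partial i (fun=> 0) x); last by rewrite partial_cst.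
by apply: (@partial_local _ _ (~` K)) => //; exact: closed_openC.
Qed.

(** Near a point outside the closed set [K] the function vanishes identically, so
[U] and the complement of [K] cover the space by open sets on which it is C^k.
This turns the coefficients, only regular on [U], into globally regular functions
once they are multiplied by a bump. *)
Lemma Ck_extend0 k U K u : open U -> closed K -> K `<=` U -> Ck k U u ->
  (forall x, ~ K x -> u x = 0) -> Ck k setT u.
Proof.
move=> oU cK KU; have UKT : setT = U `|` ~` K.
  apply/seteqP; split => x // _.
  by have [/KU|] := pselect (K x); [left|right].
have off w : (forall x, ~ K x -> w x = 0) -> forall x, (~` K) x -> 0 = w x.
  by move=> wK x /wK ->.
elim: k u => [|k IH] u Cu uK; split => //.
- move=> x; rewrite UKT => -[Ux|Kx]; first exact: Ck_cont Cu Ux.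
  apply: (continuous_local (closed_openC cK) (off _ uK) Kx).
  exact: cst_continuous.
- move=> x; rewrite UKT => -[Ux|Kx]; first exact: Ck_cont Cu Ux.
  apply: (continuous_local (closed_openC cK) (off _ uK) Kx).
  exact: cst_continuous.
- move=> i; have [di Ci] := Cu.2 i; split.
    move=> x; rewrite UKT => -[Ux|Kx]; first exact: di.
    apply: (derivable_local (closed_openC cK) (off _ uK) Kx).
    exact: derivable_cst.
  by apply: IH => // x Kx; exact: partial_off uK Kx.
Qed.

End directional_derivatives.

(** * Integration by parts *)

Section integration_by_parts.
Variables (R : realType) (n : nat).
Implicit Types (u w : 'rV[R]_n -> R) (x y : 'rV[R]_n) (K U W : set 'rV[R]_n).
Local Notation mu := (lebesgue_rV R n).

(** The difference quotients along the [i]-th axis have integral zero by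
translation invariance.  By the mean value theorem they are bounded by the
supremum of the partial derivative, and for steps at most 1 they vanish outside
a fixed ball, so dominated convergence applies. *)
Lemma Rint_partial u i : Cc u -> Cc (partial i u) ->
  (forall x, derivable u x (delta_mx 0 i)) ->
  \int[mu]_x partial i u x = 0.
Proof.
move=> cu cdu du; set e : 'rV[R]_n := delta_mx 0 i.
have [C dC] := Cc_bounded cdu.
have [cu0 [K cK uK]] := cu.
have /compact_bounded[M0 [_ MK]] := cK.
set M := `|M0| + 1; have {}MK x : K x -> `|x| <= M.
  by move=> Kx; apply: MK => //; rewrite (le_lt_trans (ler_norm _))// ltrDl.
(* Moving from outside the ball of radius [E] by a multiple [t *: e], with
   [t <= 1], cannot reach the support. *)
pose E := `|e| + M.
pose B := [set x : 'rV[R]_n | `|x| <= E].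
have cB : compact B.
  apply: bounded_closed_compact.
    exists E; split; first exact: num_real.
    by move=> r Er x /le_trans; apply; exact: ltW.
  apply: (@closed_comp _ _ (fun x : 'rV[R]_n => `|x|) [set r | r <= E]).
    by move=> x _; exact: norm_continuous.
  exact: closed_le.
pose t (k : nat) : R := k.+1%:R^-1.
have t_gt0 k : 0 < t k by rewrite invr_gt0.
have t_le1 k : t k <= 1 by rewrite invf_le1// ler1n.
pose q k x := (t k)^-1 * (u (x + t k *: e) - u x).
have cd k : Cc (fun x => u (x + t k *: e) - u x).
  apply: CcD; first exact: Cc_shift.
  have := CcZ (-1) cu; congr (Cc _); apply/funext => x; exact: mulN1r.
have cq k : Cc (q k) by exact: CcZ.
have iq k : \int[mu]_x q k x = 0.
  rewrite RintegralZl//; last exact: Cc_integrable.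
  rewrite RintegralB ?Rint_shift ?subrr ?mulr0//; apply: Cc_integrable => //.
  exact: Cc_shift.
have qC k x : `|q k x| <= C.
  have [c _] : exists2 c, c \in `]0, t k[%R &
     u (t k *: e + x) - u (0 *: e + x) = 'D_e u (c *: e + x) * (t k - 0).
    apply: (@MVT R (fun s => u (s *: e + x)) (fun s => 'D_e u (s *: e + x))) => //.
      by move=> s _; apply: is_derive_line.
    apply: continuous_subspaceT => s.
    apply: (@continuous_comp _ _ _ (fun s : R => s *: e + x) u); last exact: cu0.
    apply: continuousD; last exact: cst_continuous.
    exact: scalel_continuous.
  rewrite scale0r add0r subr0 /q [x + _]addrC => ->.
  by rewrite mulrC mulfK ?gt_eqF//; exact: dC.
have qB k x : ~ B x -> q k x = 0.
  move=> Bx; have xE : E < `|x| by rewrite ltNge; apply/negP.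
  rewrite /q !uK ?subrr ?mulr0// => /MK; apply/negP; rewrite -ltNge.
    by rewrite (le_lt_trans _ xE)// lerDr.
  have := ler_normB (x + t k *: e) (t k *: e).
  rewrite addrK normrZ gtr0_norm// => H.
  have : t k * `|e| <= `|e| by rewrite ler_piMl.
  rewrite /E in xE; lra.
have qcv x : q ^~ x @ \oo --> partial i u x.
  have := du x; rewrite /derivable => dux.
  have t0 : t @ \oo --> 0^'.
    move=> P [r /= r0 rP].
    have := @cvg_harmonic R => /cvgrPdist_lt /(_ r r0) [N _ NP].
    exists N => // k /= Nk; apply: rP; first exact: NP.
    by rewrite gt_eqF.
  apply: cvg_trans (cvg_comp _ _ t0 dux); apply: near_eq_cvg.
  by apply: nearW => k; rewrite /q /= [x + _]addrC.
have iB : mu.-integrable setT (fun x => (C * \1_B x)%:E).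
  apply: (@bounded_csupp_integrable _ _ _ B `|C|) => //.
  - by apply: measurable_funM => //; apply: measurable_indic;
    exact: measurable_compact.
  - move=> x; rewrite normrM ler_piMr// indicE.
    by case: (_ \in _); rewrite ?normr1 ?normr0.
  - by move=> x Bx; rewrite indicE memNset// mulr0.
have mE w : Cc w -> measurable_fun setT (EFin \o w).
  by move=> cw; apply/measurable_EFinP; exact: continuous_measurable cw.1.
have [] // := @dominated_convergence _ _ _ mu setT measurableT
  (fun k x => (q k x)%:E) (EFin \o partial i u) (fun x => (C * \1_B x)%:E).
- by move=> k; exact: mE.
- exact: mE.
- by apply: aeW => x _; apply/cvg_EFin; [exact: nearW|exact: qcv].
- apply: aeW => x k _; rewrite abse_EFin lee_fin indicE.
  have [Bx|Bx] := pselect (B x); first by rewrite mem_set// mulr1.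
  by rewrite qB// normr0 memNset// mulr0.
move=> _ _ H.
rewrite /Rintegral -(cvg_lim _ H)//.
rewrite (_ : (fun _ => _) = cst 0%E) ?lim_cst//.
apply/funext => k; rewrite -[LHS]fineK.
  by rewrite -[fine _]/(\int[mu]_x q k x) iq.
by apply: integrable_fin_num => //; exact: Cc_integrable.
Qed.

(** The head of the list is the outermost derivative; mixed partial derivatives
are never reordered. *)
Definition iter_partial (s : seq 'I_n) u := foldr (fun i => partial i) u s.

Lemma Ck_mul_off k U K u w : open U -> compact K -> K `<=` U ->
  Ck k setT u -> (forall x, ~ K x -> u x = 0) -> Ck k U w ->
  Ck k setT (fun x => u x * w x).
Proof.
move=> oU cK KU Cu uK Cw.
apply: (Ck_extend0 oU (rV_compact_closed cK) KU).
  by apply: CkM => //; exact: Ck_sub Cu.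
by move=> x Kx; rewrite uK// mul0r.
Qed.

Lemma Ck0_Cc K u : compact K -> Ck 0 setT u -> (forall x, ~ K x -> u x = 0) ->
  Cc u.
Proof. by move=> cK [cu _] uK; split; [move=> x; exact: cu|exists K]. Qed.

(** The product [u * w] is C^1 on the whole space because [u] cuts it off, so its
partial derivative has integral zero. *)
Lemma Rint_by_parts i U K u w : open U -> compact K -> K `<=` U ->
  Ck 1 setT u -> (forall x, ~ K x -> u x = 0) -> Ck 1 U w ->
  \int[mu]_x (u x * partial i w x) = - \int[mu]_x (partial i u x * w x).
Proof.
move=> oU cK KU Cu uK Cw.
have duK x : ~ K x -> partial i u x = 0.
  exact: partial_off (rV_compact_closed cK) uK.
have c1 : Cc (fun x => u x * partial i w x).
  apply: (@Ck0_Cc K) => //; last by move=> x Kx; rewrite uK// mul0r.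
  by apply: (Ck_mul_off oU cK KU (CkS Cu) uK); exact: (Cw.2 i).2.
have c2 : Cc (fun x => partial i u x * w x).
  apply: (@Ck0_Cc K) => //; last by move=> x Kx; rewrite duK// mul0r.
  by apply: (Ck_mul_off oU cK KU _ duK (CkS Cw)); exact: (Cu.2 i).2.
have Cuw := Ck_mul_off oU cK KU Cu uK Cw.
have cuw : Cc (fun x => u x * w x).
  by apply: (@Ck0_Cc K) => //; [exact: CkS|move=> x Kx; rewrite uK// mul0r].
have dE x : partial i (fun x => u x * w x) x =
    u x * partial i w x + partial i u x * w x.
  have [Kx|Kx] := pselect (K x).
    rewrite /partial [LHS]deriveM; first by congr (_ + _); exact: mulrC.
      exact: (Cu.2 i).1.
    by apply: (Cw.2 i).1; exact: KU.
  rewrite uK// duK// !mul0r addr0.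
  apply: partial_off (rV_compact_closed cK) _ Kx => y Ky.
  by rewrite uK// mul0r.
have := @Rint_partial (fun x => u x * w x) i cuw.
rewrite (funext dE) => /(_ (CcD c1 c2)) H.
apply/eqP; rewrite -addr_eq0 -RintegralD//; [|exact: Cc_integrable..].
by apply/eqP; apply: H => x; exact: (Cuw.2 i).1.
Qed.

Lemma Ck_iter_partial s k U w : Ck (size s + k) U w -> Ck k U (iter_partial s w).
Proof.
elim: s k => [//|i s IH] k; rewrite [size _]/= addSnnS => /IH Cw.
exact: (Cw.2 i).2.
Qed.

Lemma iter_partial_off s K u : closed K -> (forall x, ~ K x -> u x = 0) ->
  forall x, ~ K x -> iter_partial s u x = 0.
Proof. by move=> cK uK; elim: s => //= i s IH x; exact: partial_off. Qed.

(** The outermost derivative of [w] is the first one to reach [u], where it ends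
up innermost: this is why the list is reversed. *)
Lemma Rint_by_parts_iter s U K u w : open U -> compact K -> K `<=` U ->
  Ck (size s) setT u -> (forall x, ~ K x -> u x = 0) -> Ck (size s) U w ->
  \int[mu]_x (u x * iter_partial s w x) =
  (-1) ^+ size s * \int[mu]_x (iter_partial (rev s) u x * w x).
Proof.
move=> oU cK KU; elim: s u => [|i s IH] u Cu uK Cw; first by rewrite expr0 mul1r.
rewrite /= (Rint_by_parts _ oU cK KU _ uK).
- rewrite (IH (partial i u)).
  + by rewrite rev_cons /iter_partial foldr_rcons exprS mulN1r mulNr.
  + exact: (Cu.2 i).2.
  + by move=> x; exact: partial_off (rV_compact_closed cK) uK.
  + exact: CkS.
- by apply: Ck_le Cu.
- by apply: Ck_iter_partial; rewrite addn1.
Qed.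

End integration_by_parts.

(** * Bump functions *)

Section bump.
Variables (R : realType) (n : nat).
Implicit Types (u w : 'rV[R]_n -> R) (x y c : 'rV[R]_n) (K U W : set 'rV[R]_n).

Lemma is_derive_coord (k : 'I_n) x (v : 'rV[R]_n) :
  is_derive x v (fun y : 'rV[R]_n => y 0 k) (v 0 k).
Proof.
have H : h^-1 *: (((fun y : 'rV[R]_n => y 0 k) \o shift x) (h *: v) - x 0 k)
    @[h --> (0 : R)^'] --> v 0 k.
  apply: cvg_near_cst; near=> h; rewrite /= !mxE addrK.
  rewrite /GRing.scale/= mulrA mulVf ?mul1r//.
  by near: h; exact: nbhs_dnbhs_neq.
by split; [apply/cvg_ex; exists (v 0 k)|exact: cvg_lim].
Unshelve. all: by end_near. Qed.

Lemma Ck_coord k W (i : 'I_n) : open W -> Ck k W (fun x => x 0 i).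
Proof.
move=> oW; case: k => [|k]; split => //; try by move=> x _; exact: coord_continuous.
move=> j; split; first by move=> x _; apply: ex_derive; exact: is_derive_coord.
apply: (@Ck_eq _ _ _ _ (fun=> (delta_mx 0 j : 'rV[R]_n) 0 i)) => //.
  by move=> x _; rewrite /partial; have [_ ->] := is_derive_coord i x (delta_mx 0 j).
exact: Ck_cst.
Qed.

Lemma Ck_sum k W (I : Type) (s : seq I) (P : pred I)
    (u : I -> 'rV[R]_n -> R) : open W ->
  (forall i, P i -> Ck k W (u i)) -> Ck k W (fun x => \sum_(i <- s | P i) u i x).
Proof.
move=> oW cu; elim: s => [|i s IH].
  by under eq_fun do rewrite big_nil; exact: Ck_cst.
under eq_fun do rewrite big_cons; case: (boolP (P i)) => // Pi.
by apply: CkD => //; exact: cu.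
Qed.

Lemma Ck_prod k W (I : Type) (s : seq I) (u : I -> 'rV[R]_n -> R) : open W ->
  (forall i, Ck k W (u i)) -> Ck k W (fun x => \prod_(i <- s) u i x).
Proof.
move=> oW cu; elim: s => [|i s IH].
  by under eq_fun do rewrite big_nil; exact: Ck_cst.
by under eq_fun do rewrite big_cons; exact: CkM.
Qed.

Lemma Ck_horner k W (p : {poly R}) u : open W -> Ck k W u ->
  Ck k W (fun x => p.[u x]).
Proof.
move=> oW cu; elim/poly_ind: p => [|p a IH].
  by under eq_fun do rewrite horner0; exact: Ck_cst.
under eq_fun do rewrite hornerMXaddC.
by apply: CkD => //; [exact: CkM|exact: Ck_cst].
Qed.

Lemma is_derive_comp1 (f g : R -> R) (x df dg : R) :
  is_derive x 1 f df -> is_derive (f x) 1 g dg ->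
  is_derive x 1 (g \o f) (dg * df).
Proof.
move=> [fx <-] [gx <-]; split.
  apply: ((derivable1_diffP _ _).2 (differentiable_comp _ _)).
    exact: (derivable1_diffP _ _).1.
  exact: (derivable1_diffP _ _).1.
by have := derive1_comp fx gx; rewrite !derive1E.
Qed.

Lemma is_derive_comp (g : R -> R) u x (v : 'rV[R]_n) (dg : R) :
  derivable u x v -> is_derive (u x) 1 g dg ->
  is_derive x v (fun y => g (u y)) (dg * 'D_v u x).
Proof.
move=> du gx; pose l t := u (t *: v + x).
have xE : 0 *: v + x = x by rewrite scale0r add0r.
have l0 : l 0 = u x by rewrite /l xE.
have lu : is_derive (0 : R) (1 : R) l ('D_v u x).
  by have := @is_derive_line R n u x v 0; rewrite xE; exact.
have gl : is_derive (0 : R) (1 : R) (g \o l) (dg * 'D_v u x).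
  by apply: is_derive_comp1; rewrite ?l0.
have dgux : derivable (fun y => g (u y)) x v.
  by apply/derivable1P; exact: (@ex_derive _ _ _ _ _ _ _ gl).
split => //; rewrite -[RHS](@derive_val _ _ _ _ _ _ _ gl).
have [|_ ->] := @is_derive_line R n (fun y => g (u y)) x v 0; rewrite ?xE//.
Qed.

(** At 0 the difference quotient is at most [h ^+ N.+1], which tends to 0. *)
Lemma is_derive_pospart (N : nat) (r : R) :
  is_derive r 1 (fun s : R => Num.max 0 s ^+ N.+2)
    (N.+2%:R * Num.max 0 r ^+ N.+1).
Proof.
have [r0|r0|->] := ltgtP r 0.
- rewrite expr0n/= mulr0.
  apply: (@near_eq_is_derive _ _ _ (cst 0)).
  near=> s; rewrite max_l ?expr0n//.
  by apply: ltW; near: s; exact: lt_nbhsl.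
- have dX : is_derive r 1 (fun s : R => s ^+ N.+2) (N.+2%:R * r ^+ N.+1).
    split; first exact: exprn_derivable.
    by rewrite exp_derive [LHS]mulr1 [LHS]mulr_natl mulr_natl.
  apply: (@near_eq_is_derive R R R (fun s : R => s ^+ N.+2)
    (fun s : R => Num.max 0 s ^+ N.+2)); near=> s; rewrite max_r//.
  by apply: ltW; near: s; exact: lt_nbhsr.
- rewrite expr0n/= mulr0.
  have H : h^-1 *: (((fun s : R => Num.max 0 s ^+ N.+2) \o shift 0) (h *: 1) -
       Num.max 0 0 ^+ N.+2) @[h --> (0 : R)^'] --> (0 : R).
    apply/cvgrPdist_lt => e e0; near=> h.
    rewrite /= maxxx expr0n/= subr0 sub0r normrN addr0 [h *: 1]mulr1.
    have he : `|h| < e by near: h; exact: dnbhs0_lt.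
    have h1 : `|h| < 1 by near: h; exact: dnbhs0_lt.
    have [h0|h0] := leP h 0; first by rewrite expr0n/= scaler0 normr0.
    rewrite exprS /GRing.scale/= mulrA mulVf ?gt_eqF// mul1r.
    rewrite normrX exprS (le_lt_trans _ he)// ler_piMr//.
    by rewrite exprn_ile1// ltW.
  by split; [apply/cvg_ex; exists 0|exact: cvg_lim].
Unshelve. all: by end_near. Qed.

(** Each derivative lowers the exponent of the positive part by one, and the last
one left is still continuous. *)
Lemma Ck_pospart N (P : 'rV[R]_n -> R) : (forall k, Ck k setT P) ->
  Ck N setT (fun x => Num.max 0 (P x) ^+ N.+1).
Proof.
move=> CP; have cP : continuous P by move=> x; exact: Ck_cont (CP 0%N) _.
have cmax k : continuous (fun x => Num.max 0 (P x) ^+ k).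
  move=> x; apply: (@continuous_comp _ _ _ (fun x => Num.max 0 (P x))
    (fun r : R => r ^+ k)).
    by apply: continuous_max; [exact: cst_continuous|exact: cP].
  exact: exprn_continuous.
elim: N => [|N IH]; first by split => // x _; exact: cmax.
split; first by move=> x _; exact: cmax.
move=> i.
have dP x : is_derive x (delta_mx 0 i) (fun x => Num.max 0 (P x) ^+ N.+2)
    (N.+2%:R * Num.max 0 (P x) ^+ N.+1 * partial i P x).
  apply: (@is_derive_comp (fun s : R => Num.max 0 s ^+ N.+2)).
    exact: ((CP 1%N).2 i).1.
  exact: is_derive_pospart.
split; first by move=> x _; apply: ex_derive; exact: dP.
apply: (@Ck_eq _ _ _ _
    (fun x => N.+2%:R * Num.max 0 (P x) ^+ N.+1 * partial i P x)).
- exact: openT.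
- by move=> x _; rewrite /partial; have [_ ->] := dP x.
apply: CkM; [exact: openT| |exact: ((CP N.+1).2 i).2].
by apply: CkM => //; [exact: openT|exact: Ck_cst].
Qed.

(** A polynomial whose positive part, once raised to the power [N.+1], is C^N; it
is positive on the open Euclidean ball of centre [c] and radius [d] and vanishes
elsewhere. *)
Definition bump_fun c (d : R) (N : nat) x : R :=
  Num.max 0 (d ^+ 2 - \sum_i (x 0 i - c 0 i) ^+ 2) ^+ N.+1.

Lemma Ck_bump c d N : Ck N setT (bump_fun c d N).
Proof.
apply: Ck_pospart => k; have oT := @openT 'rV[R]_n.
apply: CkD => //; first exact: Ck_cst.
have C1 i : Ck k setT (fun x => (x 0 i - c 0 i) ^+ 2).
  have C0 : Ck k setT (fun x => x 0 i - c 0 i).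
    by apply: CkD => //; [exact: Ck_coord|exact: Ck_cst].
  by under eq_fun do rewrite expr2; exact: CkM.
apply: (@Ck_eq _ _ _ _ (fun x => -1 * \sum_i (x 0 i - c 0 i) ^+ 2)) => //.
  by move=> x _; rewrite mulN1r.
by apply: CkM => //; [exact: Ck_cst|exact: Ck_sum].
Qed.

Lemma bump_ge0 c d N x : 0 <= bump_fun c d N x.
Proof. by rewrite exprn_ge0// le_max lexx. Qed.

Lemma bump_gt0 c d N : 0 < d -> 0 < bump_fun c d N c.
Proof.
move=> d0; rewrite exprn_gt0// lt_max; apply/orP; right.
by rewrite big1 ?subr0 ?exprn_gt0// => i _; rewrite subrr expr0n.
Qed.

Lemma bump_off c d N x : 0 <= d ->
  ~ (forall i, x 0 i \in `[c 0 i - d, c 0 i + d]) -> bump_fun c d N x = 0.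
Proof.
move=> d0 /existsNP[i xi]; rewrite /bump_fun max_l ?expr0n//.
rewrite subr_le0 (bigD1 i)//= -[leLHS]addr0 lerD//; last first.
  by apply: sumr_ge0 => j _; exact: sqr_ge0.
rewrite leNgt; apply/negP => /ltW H; apply: xi.
rewrite in_itv/= -ler_distl -(@ler_pXn2r _ 2) ?nnegrE//.
by rewrite real_normK ?num_real.
Qed.

End bump.

(** * Iterated derivatives and monomials *)

Section test_functions.
Variables (R : realType) (n : nat).
Implicit Types (u w : 'rV[R]_n -> R) (x y c : 'rV[R]_n) (K U W : set 'rV[R]_n).

(** The order of differentiation chosen by [mpartial]. *)
Definition index_seq (a : 'I_n -> nat) : seq 'I_n :=
  flatten [seq nseq (a i) i | i <- enum 'I_n].

Lemma size_index_seq a : size (index_seq a) = mdegree a.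
Proof.
rewrite size_flatten /shape -map_comp sumnE big_map /mdegree big_enum.
by apply: eq_bigr => i _ /=; rewrite size_nseq.
Qed.

Lemma count_index_seq a k : count_mem k (index_seq a) = a k.
Proof.
rewrite count_flatten -map_comp sumnE big_map big_enum /=.
rewrite (bigD1 k)//= count_nseq /= eqxx mul1n big1 ?addn0// => i ik.
by rewrite count_nseq /= (negbTE ik).
Qed.

Lemma mpartialE a w : mpartial a w = iter_partial (index_seq a) w.
Proof.
rewrite /mpartial /index_seq; elim: (enum 'I_n) => //= i s ->.
by rewrite /iter_partial foldr_cat; elim: (a i) => //= k ->.
Qed.

Lemma Ck_mpartial a k U w : Ck (mdegree a + k) U w -> Ck k U (mpartial a w).
Proof. by rewrite mpartialE -size_index_seq; exact: Ck_iter_partial. Qed.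

Lemma iter_partial_local s W u w x : open W -> (forall y, W y -> u y = w y) -> W x ->
  iter_partial s u x = iter_partial s w x.
Proof.
move=> oW uw; elim: s x => [|i s IH] x Wx /=; first exact: uw.
by apply: (@partial_local _ _ _ _ W).
Qed.

Definition prod_poly (p : 'I_n -> {poly R}) c x : R :=
  \prod_k (p k).[x 0 k - c 0 k].

Lemma Ck_prod_poly k p c W : open W -> Ck k W (prod_poly p c).
Proof.
move=> oW; apply: Ck_prod => // i; apply: Ck_horner => //.
by apply: CkD => //; [exact: Ck_coord|exact: Ck_cst].
Qed.

(** Along the [i]-th axis only the [i]-th factor varies. *)
Lemma partial_prod_poly i p c : partial i (prod_poly p c) =
  prod_poly (fun k => if k == i then (p k)^`() else p k) c.
Proof.
apply/funext => x; set e : 'rV[R]_n := delta_mx 0 i.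
have dp : derivable (prod_poly p c) x e.
  by apply: ((@Ck_prod_poly 1 p c setT openT).2 i).1.
pose C := \prod_(k | k != i) (p k).[x 0 k - c 0 k].
have pE y : (forall k, k != i -> y 0 k = x 0 k) ->
    prod_poly p c y = C * (p i).[y 0 i - c 0 i].
  move=> yx; rewrite /prod_poly (bigD1 i)//= mulrC; congr (_ * _).
  by apply: eq_bigr => k ki; rewrite yx.
have := @is_derive_line R n (prod_poly p c) x e 0.
rewrite scale0r add0r => /(_ dp) [_].
rewrite /partial -/e => <-.
rewrite (_ : (fun t : R => _) =
  horner (C%:P * (p i \Po ('X + (x 0 i - c 0 i)%:P)))); last first.
  apply/funext => t; rewrite pE; last first.
    by move=> k ki; rewrite !mxE eqxx (negbTE ki) mulr0 add0r.
  by rewrite !hornerE horner_comp !hornerE !mxE !eqxx /= mulr1.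
set q := C%:P * _.
have <- : q^`().[0] = 'D_1 (horner q) 0 by rewrite derivE derive1E.
rewrite derivM derivC mul0r add0r deriv_comp.
rewrite derivD derivX derivC addr0 mulr1 !hornerE horner_comp !hornerE.
rewrite /prod_poly (bigD1 i)//= eqxx mulrC; congr (_ * _).
by apply: eq_bigr => k ki; rewrite (negbTE ki).
Qed.

Lemma iter_partial_prod_poly s p c : iter_partial s (prod_poly p c) =
  prod_poly (fun k => (p k)^`(count_mem k s)) c.
Proof.
elim: s => [|i s IH] /=.
  by congr (prod_poly _ c); apply/funext => k; rewrite derivn0.
rewrite IH partial_prod_poly; congr (prod_poly _ c); apply/funext => k.
by rewrite eq_sym; case: eqP => _; rewrite ?add1n ?derivnS ?add0n.
Qed.

Definition monomial (a : 'I_n -> nat) := prod_poly (fun k => 'X^(a k)).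

(** At the centre [c] only the constant term of each differentiated factor is left:
it is the factorial of [a k] if [b k = a k], and zero otherwise. *)
Lemma mpartial_monomial a b c :
  (mpartial b (monomial a c) c != 0) = [forall k, b k == a k].
Proof.
rewrite mpartialE iter_partial_prod_poly /prod_poly.
apply/idP/forallP => [+ k|ba].
  apply: contraNT => bak; apply/prodf_eq0; exists k => //.
  rewrite subrr count_index_seq derivnXn hornerMn hornerXn.
  rewrite expr0n subn_eq0; case: leqP => ab; last by rewrite mul0rn.
  by rewrite ffact_small ?mulr0n// ltn_neqAle eq_sym bak.
apply/prodf_neq0 => k _; rewrite subrr count_index_seq derivnXn hornerMn hornerXn.
by rewrite (eqP (ba k)) subnn expr0 ffactnn pnatr_eq0 -lt0n fact_gt0.
Qed.

End test_functions.

(** * The formal adjoint *)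

Section duality.
Variables (R : realType) (n : nat) (L : ddop R n).
Implicit Types (u w phi : 'rV[R]_n -> R) (x y c : 'rV[R]_n) (B K U W : set 'rV[R]_n).
Local Notation mu := (lebesgue_rV R n).
Local Notation v := (shift_vec L).

Lemma translateE A c : translate A c = (fun x => x - c) @^-1` A.
Proof.
apply/seteqP; split => [_ [x Ax <-]|x Ax]; first by rewrite /= addrK.
by exists (x - c) => //; rewrite subrK.
Qed.

Lemma open_translate A c : open A -> open (translate A c).
Proof.
by rewrite translateE; apply: open_comp => x _; exact: continuous_shiftD.
Qed.

Lemma compact_translate A c : compact A -> compact (translate A c).
Proof.
by move=> cA; apply: continuous_compact => //; apply: continuous_subspaceT;
  exact: continuous_shiftD.
Qed.

Lemma sub_translate A B c : A `<=` B -> translate A c `<=` translate B c.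
Proof. exact: image_subset. Qed.

(** The contribution of one coefficient: translating by [v j] moves the shift from
the test function to [coeff L j a * phi], and the sign comes from integrating by
parts [mdegree a] times. *)
Definition adjoint_term phi j (a : 'I_n -> nat) x : R :=
  (-1) ^+ mdegree a *
  iter_partial (rev (index_seq a))
    (fun y => coeff L j a (y - v j) * phi (y - v j)) x.

Definition adjoint phi x : R :=
  \sum_(j < (nshift L).+1)
    \sum_(a : {ffun 'I_n -> 'I_(Defs.order L j).+1} |
          (mdegree (fun i => a i : nat) <= Defs.order L j)%N)
      adjoint_term phi j (fun i => a i : nat) x.

Section adjoint.
Variables (B K : set 'rV[R]_n) (phi : 'rV[R]_n -> R).
Hypotheses (oB : open B) (cK : compact K) (KB : K `<=` B)
  (Cphi : Ck (max_order L) setT phi) (phiK : forall x, ~ K x -> phi x = 0)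
  (Ccoeff : forall j a, (mdegree a <= Defs.order L j)%N ->
     Ck (mdegree a) B (coeff L j a)).

Let psi j a y := coeff L j a (y - v j) * phi (y - v j).

Lemma order_le_max j : (Defs.order L j <= max_order L)%N.
Proof. exact: (@leq_bigmax _ (Defs.order L) j). Qed.

Lemma cphi_Ck j (a : 'I_n -> nat) : (mdegree a <= Defs.order L j)%N ->
  Ck (mdegree a) setT (fun y => coeff L j a y * phi y).
Proof.
move=> aj; apply: (Ck_extend0 oB (rV_compact_closed cK) KB).
  apply: CkM => //; first exact: Ccoeff.
  by apply: Ck_le (Ck_sub _ Cphi) => //; exact: leq_trans aj (order_le_max j).
by move=> x Kx; rewrite phiK// mulr0.
Qed.

Lemma psi_Ck j a : (mdegree a <= Defs.order L j)%N ->
  Ck (mdegree a) setT (psi j a).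
Proof. by move=> aj; exact: (Ck_shift (- v j) (cphi_Ck aj)). Qed.

Lemma psi_off j a x : ~ translate K (v j) x -> psi j a x = 0.
Proof. by rewrite translateE /psi => Kx; rewrite phiK// mulr0. Qed.

Lemma adjoint_term_Ck0 j a : (mdegree a <= Defs.order L j)%N ->
  Ck 0 setT (adjoint_term phi j a).
Proof.
move=> aj; apply: CkM; [exact: openT|exact: Ck_cst|].
by apply: Ck_iter_partial; rewrite size_rev size_index_seq addn0; exact: psi_Ck.
Qed.

Lemma adjoint_term_off j a x : ~ translate K (v j) x ->
  adjoint_term phi j a x = 0.
Proof.
have cKj : compact (translate K (v j)) by exact: compact_translate.
move=> Kx; rewrite /adjoint_term.
rewrite (iter_partial_off _ (rV_compact_closed cKj) _ Kx) ?mulr0//.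
exact: psi_off.
Qed.

Lemma adjoint_off x : ~ shifted_union L K x -> adjoint phi x = 0.
Proof.
move=> Kx; apply: big1 => j _; apply: big1 => a _.
by apply: adjoint_term_off => Kjx; apply: Kx; exists j.
Qed.

Lemma adjoint_Cc : Cc (adjoint phi).
Proof.
apply: Cc_sum => j _; apply: Cc_sum => a aj.
apply: (@Ck0_Cc _ _ (translate K (v j))).
- exact: compact_translate.
- exact: adjoint_term_Ck0.
- by move=> x; exact: adjoint_term_off.
Qed.

(** Term by term: translation invariance removes the shift, then the derivatives are
moved over on the shifted copy of [B], where [w] is regular.  The cut-off by
[phi] makes every integrand continuous with compact support. *)
Lemma adjoint_duality w : Ck (max_order L) (shifted_union L B) w ->
  [/\ Cc (fun x => adjoint phi x * w x), Cc (fun x => phi x * ddop_apply L w x) &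
   \int[mu]_x (adjoint phi x * w x) = \int[mu]_x (phi x * ddop_apply L w x)].
Proof.
move=> Cw.
have Cwj j (a : 'I_n -> nat) : (mdegree a <= Defs.order L j)%N ->
    Ck (mdegree a) (translate B (v j)) w.
  move=> aj; apply: (Ck_le (leq_trans aj (order_le_max j))).
  by apply: Ck_sub Cw => x Bx; exists j.
have oBj j : open (translate B (v j)) by exact: open_translate.
have cKj j : compact (translate K (v j)) by exact: compact_translate.
have KBj j : translate K (v j) `<=` translate B (v j) by exact: sub_translate.
have c1 j (a : 'I_n -> nat) : (mdegree a <= Defs.order L j)%N ->
    Cc (fun x => adjoint_term phi j a x * w x).
  move=> aj; apply: (Ck0_Cc (cKj j)).
    apply: (Ck_mul_off (oBj j) (cKj j) (KBj j)).
    - exact: adjoint_term_Ck0.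
    - by move=> x; exact: adjoint_term_off.
    - exact: (Ck_le (leq0n _) (Cwj j a aj)).
  by move=> x Kx; rewrite adjoint_term_off// mul0r.
have c2 j (a : 'I_n -> nat) : (mdegree a <= Defs.order L j)%N ->
    Cc (fun x => psi j a x * mpartial a w x).
  move=> aj; apply: (Ck0_Cc (cKj j)).
    apply: (Ck_mul_off (oBj j) (cKj j) (KBj j)).
    - exact: (Ck_le (leq0n _) (psi_Ck aj)).
    - by move=> x; exact: psi_off.
    - by apply: Ck_mpartial; rewrite addn0; exact: Cwj.
  by move=> x Kx; rewrite psi_off// mul0r.
have c3 j (a : 'I_n -> nat) : (mdegree a <= Defs.order L j)%N ->
    Cc (fun x => coeff L j a x * phi x * mpartial a w (x + v j)).
  move=> aj; have := Cc_shift (v j) (c2 j a aj).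
  by congr Cc; apply/funext => x; rewrite /psi addrK.
have E (a : 'I_n -> nat) j : (mdegree a <= Defs.order L j)%N ->
    \int[mu]_x (adjoint_term phi j a x * w x) =
    \int[mu]_x (coeff L j a x * phi x * mpartial a w (x + v j)).
  move=> aj; transitivity (\int[mu]_x (psi j a x * mpartial a w x)).
    rewrite mpartialE (Rint_by_parts_iter (oBj j) (cKj j) (KBj j))//.
    - rewrite size_index_seq -RintegralZl//; last first.
        apply: Cc_integrable; have := CcZ ((-1) ^+ mdegree a) (c1 j a aj).
        by congr Cc; apply/funext => x; rewrite -mulrA signrMK.
      by apply: eq_Rintegral => x _; rewrite mulrA.
    - by rewrite size_index_seq; exact: psi_Ck.
    - by move=> x; exact: psi_off.
    - by rewrite size_index_seq; exact: Cwj.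
  rewrite -(Rint_shift (v j) (c2 j a aj)).
  by apply: eq_Rintegral => x _; rewrite /psi addrK.
have LE x : phi x * ddop_apply L w x = \sum_(j < (nshift L).+1)
    \sum_(a : {ffun 'I_n -> 'I_(Defs.order L j).+1} |
          (mdegree (fun i => a i : nat) <= Defs.order L j)%N)
      coeff L j (fun i => a i : nat) x * phi x *
      mpartial (fun i => a i : nat) w (x + v j).
  rewrite mulr_sumr; apply: eq_bigr => j _; rewrite mulr_sumr.
  by apply: eq_bigr => a _; rewrite mulrA [phi x * _]mulrC.
have hE x : adjoint phi x * w x = \sum_(j < (nshift L).+1)
    \sum_(a : {ffun 'I_n -> 'I_(Defs.order L j).+1} |
          (mdegree (fun i => a i : nat) <= Defs.order L j)%N)
      adjoint_term phi j (fun i => a i : nat) x * w x.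
  by rewrite mulr_suml; apply: eq_bigr => j _; rewrite mulr_suml.
rewrite (funext LE) (funext hE); split.
- by apply: Cc_sum => j _; apply: Cc_sum => a; exact: c1.
- by apply: Cc_sum => j _; apply: Cc_sum => a; exact: c3.
rewrite !Rint_sum; first last.
- by move=> j _; apply: Cc_sum => a; exact: c1.
- by move=> j _; apply: Cc_sum => a; exact: c3.
apply: eq_bigr => j _; rewrite !Rint_sum; first last.
- by move=> a; exact: c1.
- by move=> a; exact: c3.
by apply: eq_bigr => a aj; exact: E.
Qed.

End adjoint.
End duality.

(** * Disjointness of the shifted balls *)

Section euclidean_balls.
Variables (R : realType) (n : nat).
Implicit Types (x y c : 'rV[R]_n).

Lemma enorm_lt x (r : R) : 0 < r -> (enorm x < r) = (\sum_i x 0 i ^+ 2 < r ^+ 2).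
Proof.
move=> r0; have s0 : 0 <= \sum_i x 0 i ^+ 2.
  by apply: sumr_ge0 => i _; exact: sqr_ge0.
by rewrite -[in RHS](sqr_sqrtr s0) ltr_pXn2r// nnegrE ?sqrtr_ge0// ltW.
Qed.

Lemma open_eball c (r : R) : open (eball c r).
Proof.
have cN : continuous (fun x : 'rV[R]_n => enorm (x - c)).
  move=> x; apply: (@continuous_comp _ _ _
    (fun x : 'rV[R]_n => \sum_i (x - c) 0 i ^+ 2) Num.sqrt).
    apply: (@Ck_cont _ _ 0 setT) => //; apply: Ck_sum => [|i _]; first exact: openT.
    apply: (@Ck_eq _ _ _ _ (fun x => (x 0 i - c 0 i) * (x 0 i - c 0 i))).
    - exact: openT.
    - by move=> y _; rewrite !mxE expr2.
    - have oT := @openT 'rV[R]_n.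
      have Ci : Ck 0 setT (fun x => x 0 i - c 0 i).
        by apply: CkD => //; [exact: Ck_coord|exact: Ck_cst].
      exact: CkM.
  exact: sqrt_continuous.
rewrite (_ : eball c r = (fun x => enorm (x - c)) @^-1` [set s | s < r])//.
by apply: open_comp => [x _|]; [exact: cN|exact: open_lt].
Qed.

(** The parallelogram inequality gives the factor 2. *)
Lemma enormB_lt x y (r : R) : 0 < r -> enorm x < r -> enorm y < r ->
  enorm (x - y) < 2 * r.
Proof.
move=> r0; rewrite !enorm_lt ?mulr_gt0// => xr yr.
have : \sum_i (x - y) 0 i ^+ 2 <= 2 * \sum_i x 0 i ^+ 2 + 2 * \sum_i y 0 i ^+ 2.
  rewrite !mulr_sumr -big_split/=; apply: ler_sum => i _; rewrite !mxE.
  rewrite -subr_ge0 (_ : _ - _ = (x 0 i + y 0 i) ^+ 2) ?sqr_ge0//; ring.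
by rewrite exprMn; lra.
Qed.

Lemma eball_translate_disjoint c u v (r : R) x : 0 < r ->
  r < 2^-1 * enorm (u - v) ->
  translate (eball c r) u x -> translate (eball c r) v x -> False.
Proof.
move=> r0 ruv; rewrite !translateE /eball /= => xu xv.
have := enormB_lt r0 xv xu.
rewrite (_ : x - v - c - (x - u - c) = u - v); last first.
  by apply/rowP => i; rewrite !mxE; ring.
by move: ruv; lra.
Qed.

End euclidean_balls.

(** * Nontriviality of the adjoint *)

Section nontrivial_adjoint.
Variables (R : realType) (n : nat) (L : ddop R n) (B : set 'rV[R]_n).
Implicit Types (u w phi : 'rV[R]_n -> R) (x y c : 'rV[R]_n).
Local Notation mu := (lebesgue_rV R n).
Local Notation v := (shift_vec L).
Hypotheses (oB : open B)
  (Ccoeff : forall j a, (mdegree a <= Defs.order L j)%N ->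
     Ck (mdegree a) B (coeff L j a))
  (disj : forall i j x, i != j -> translate B (v i) x ->
     translate B (v j) x -> False).

(** Gluing a monomial on the [j]-th shifted ball with 0 on the others is legitimate
because the shifted balls are open and disjoint; it isolates the coefficient
[(j, a)] of the operator at [c]. *)
Lemma exists_test_function j a c : (mdegree a <= Defs.order L j)%N -> B c ->
  coeff L j a c != 0 ->
  exists w, (forall k, Ck k (shifted_union L B) w) /\ ddop_apply L w c != 0.
Proof.
move=> aj Bc ac; pose Bj i := translate B (v i).
have oBj i : open (Bj i) by exact: open_translate.
pose w0 := monomial a (c + v j).
pose w := w0 \_ (Bj j).
have w_in y : Bj j y -> w0 y = w y by move=> By; rewrite /w patchE mem_set.
have w_out i y : i != j -> Bj i y -> 0 = w y.
  by move=> ij By; rewrite /w patchE memNset// => Bjy; exact: disj ij By Bjy.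
have dw i s : i != j -> iter_partial s w (c + v i) = 0.
  move=> ij; have Bi : Bj i (c + v i) by exists c.
  rewrite -(iter_partial_local s (oBj i) (w_out i ^~ ij) Bi).
  elim: s {Bi} (c + v i) => //= k s IH y.
  by rewrite (_ : iter_partial _ _ = fun=> 0) ?partial_cst//; apply/funext.
exists w; split.
  move=> k; apply: Ck_bigcup => i; have [->|ij] := eqVneq i j.
    by apply: Ck_eq w_in _ => //; exact: Ck_prod_poly.
  by apply: (Ck_eq _ (w_out i ^~ ij)) => //; exact: Ck_cst.
rewrite /ddop_apply (bigD1 j)//= [X in _ + X]big1 ?addr0; last first.
  by move=> i ij; apply: big1 => b _; rewrite mpartialE dw ?mulr0.
have ltaj k : (a k < (Defs.order L j).+1)%N.
  rewrite ltnS; apply: leq_trans aj; rewrite /mdegree (bigD1 k)//=.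
  exact: leq_addr.
pose a' := [ffun k => Ordinal (ltaj k)].
have a'E : (fun k => a' k : nat) = a by apply/funext => k; rewrite ffunE.
have Bjc : Bj j (c + v j) by exists c.
have pE b : mpartial b w (c + v j) = mpartial b w0 (c + v j).
  by rewrite !mpartialE -(iter_partial_local _ (oBj j) w_in Bjc).
rewrite (bigD1 a')/= ?a'E// big1 ?addr0.
  rewrite pE mulf_neq0//; have := mpartial_monomial a a (c + v j).
  by move=> ->; apply/forallP.
move=> b /andP[_ ba]; rewrite pE.
have := mpartial_monomial a (fun k => b k : nat) (c + v j).
case: forallP => [ba'|_ /negbFE/eqP ->]; last by rewrite mulr0.
move: ba; rewrite (_ : b = a') ?eqxx//; apply/ffunP => k.
by apply/val_inj; rewrite ffunE/=; exact/eqP/(ba' k).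
Qed.

Lemma ddop_apply_Ck0 w : Ck (max_order L) (shifted_union L B) w ->
  Ck 0 B (ddop_apply L w).
Proof.
move=> Cw; apply: Ck_sum => // j _; apply: Ck_sum => // a aj.
apply: CkM => //; first exact: (Ck_le (leq0n _) (Ccoeff aj)).
apply: (@Ck_sub _ _ _ _ ((fun x => x + v j) @^-1` shifted_union L B)).
  by move=> x Bx; exists j => //; exists x.
apply: (Ck_shift (v j)); apply: Ck_mpartial; rewrite addn0.
exact: (Ck_le (leq_trans aj (order_le_max j)) Cw).
Qed.

(** If the adjoint of every bump vanished, duality would make the integral of
[phi * L w] zero, whereas it has the sign of [L w] at the centre of a concentrated
bump. *)
Lemma exists_nonzero_adjoint : nontrivial_on B L ->
  exists phi K, [/\ compact K, K `<=` B, Ck (max_order L) setT phi,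
    (forall x, ~ K x -> phi x = 0) & exists x, adjoint L phi x != 0].
Proof.
move=> [j [a [aj [c Bc ac]]]].
have [w [Cw wc]] := exists_test_function aj Bc ac.
set q := ddop_apply L w in wc; set s := q c in wc.
(* Multiplying by [s] avoids distinguishing the sign of [q c]. *)
have s2 : 0 < s * s by rewrite -expr2 exprn_even_gt0.
have Cq : Ck 0 B (fun x => s * q x).
  by apply: CkM => //; [exact: Ck_cst|exact: ddop_apply_Ck0].
have : \forall x \near c, B x /\ 0 < s * q x.
  apply: filterI; first exact: open_nbhs_nbhs.
  have := Ck_cont Cq Bc => /cvgrPdist_lt /(_ _ s2); apply: filterS => x.
  by rewrite ltr_norml => /andP[_]; rewrite -/s; lra.
move=> /nbhs_ballP[e /= e0 eB].
pose d := e / 2; have d0 : 0 < d by rewrite divr_gt0.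
pose K := [set x : 'rV[R]_n | forall i, `[c 0 i - d, c 0 i + d]%classic (x 0 i)].
have cK : compact K.
  by apply: (@rV_compact _ _ (fun i => `[c 0 i - d, c 0 i + d]%classic)) => i;
    exact: segment_compact.
have KB x : K x -> B x /\ 0 < s * q x.
  move=> Kx; apply: eB; split => // i k; rewrite (ord1 i) /ball/=.
  have := Kx k; rewrite /= in_itv/= -ler_distl distrC => /le_lt_trans; apply.
  by rewrite /d; lra.
pose phi := bump_fun c d (max_order L).
have phiK x : ~ K x -> phi x = 0 by apply: bump_off; exact: ltW.
exists phi, K; split => //.
- by move=> x /KB[].
- exact: Ck_bump.
apply: contrapT => /forallNP h0.
have {}h0 x : adjoint L phi x = 0 by apply/eqP/negPn/negP; exact: h0.
have KB' : K `<=` B by move=> x /KB[].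
have [_ cq hq] :=
  adjoint_duality oB cK KB' (Ck_bump _ _ _) phiK Ccoeff (Cw (max_order L)).
have : 0 < \int[mu]_x (s * (phi x * q x)).
  apply: (@Rint_gt0 _ _ _ c); first exact: CcZ.
    move=> x; have [Kx|Kx] := pselect (K x).
      by rewrite mulrCA mulr_ge0 ?bump_ge0// ltW//; case: (KB x Kx).
    by rewrite phiK// mul0r mulr0.
  by rewrite mulrCA mulr_gt0 ?bump_gt0.
rewrite RintegralZl//; last exact: Cc_integrable.
rewrite -hq (_ : Rintegral _ _ _ = 0) ?mulr0 ?ltxx//.
rewrite /Rintegral (eq_integral (cst 0%E)) ?integral0// => x _.
by rewrite h0 mul0r.
Qed.

End nontrivial_adjoint.

(** * Measures with a density *)

Section density.
Local Open Scope ereal_scope.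
Context d (T : measurableType d) (R : realType).
Variable mu : {sigma_finite_measure set T -> \bar R}.

(** The Radon-Nikodym derivative of [P] satisfies this change of variables, and it
agrees almost everywhere with any other density. *)
Lemma integral_density (P : {finite_measure set T -> \bar R}) (g F : T -> R) :
  measurable_fun setT g -> (forall x, 0 <= g x)%R ->
  (forall A, measurable A -> P A = \int[mu]_(x in A) (g x)%:E) ->
  measurable_fun setT F -> (forall x, 0 <= F x)%R ->
  \int[P]_x (F x)%:E = \int[mu]_x (F x * g x)%:E.
Proof.
move=> mg g0 Pg mF F0.
have mEg : measurable_fun setT (EFin \o g) by exact/measurable_EFinP.
have mEF : measurable_fun setT (EFin \o F) by exact/measurable_EFinP.
have Pmu : P `<< mu.
  apply/null_content_dominatesP => A mA A0; rewrite Pg//.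
  by apply: null_set_integral => //; exact: measurable_funTS.
have iRN := Radon_Nikodym_SigmaFinite.f_integrable Pmu.
rewrite -(Radon_Nikodym_SigmaFinite.change_of_variables Pmu)//.
apply: ae_eq_integral => //.
- by apply: emeasurable_funM => //; exact: measurable_int iRN.
- exact/measurable_EFinP/measurable_funM.
under [X in ae_eq _ _ _ X]eq_fun do rewrite EFinM.
apply: ae_eqe_mul2l; apply: integral_ae_eq => // E _ mE.
by rewrite -Radon_Nikodym_SigmaFinite.f_integral// Pg.
Qed.

Section density_probability.
Variable k : T -> R.
Hypotheses (mk : measurable_fun setT k) (k0 : forall x, (0 <= k x)%R)
  (k1 : \int[mu]_x (k x)%:E = 1).

Definition density_measure (A : set T) : \bar R := \int[mu]_(x in A) (k x)%:E.

Let density0 : density_measure set0 = 0.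
Proof. by rewrite /density_measure integral_set0. Qed.

Let density_ge0 A : 0 <= density_measure A.
Proof. by apply: integral_ge0 => x _; rewrite lee_fin. Qed.

Let density_sigma_additive : semi_sigma_additive density_measure.
Proof.
move=> A mA tA mUA; rewrite /density_measure ge0_integral_bigcup//; last 2 first.
- exact/measurable_funTS/measurable_EFinP.
- by move=> x _; rewrite lee_fin.
by apply: is_cvg_ereal_nneg_natsum_cond => n _ _; exact: density_ge0.
Qed.

HB.instance Definition _ := isMeasure.Build _ _ _
  density_measure density0 density_ge0 density_sigma_additive.

HB.instance Definition _ :=
  @Measure_isProbability.Build _ _ R density_measure k1.

Lemma exists_probability_density : exists P : probability T R,
  forall A, measurable A -> P A = \int[mu]_(x in A) (k x)%:E.
Proof. by exists density_measure. Qed.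

End density_probability.

(** The later identities between integrals have possibly infinite terms;
splitting the signed perturbation isolates the finite ones that may be
subtracted. *)
Lemma integral_posneg (F h : T -> R) (A : set T) : measurable A ->
  measurable_fun setT F -> measurable_fun setT h -> (forall x, 0 <= F x)%R ->
  mu.-integrable setT (fun x => (F x * h x)%:E) ->
  [/\ \int[mu]_(x in A) (F x * Num.max 0 (h x))%:E \is a fin_num,
      \int[mu]_(x in A) (F x * Num.max 0 (- h x))%:E \is a fin_num &
      \int[mu]_(x in A) (F x * h x)%:E =
      \int[mu]_(x in A) (F x * Num.max 0 (h x))%:E -
      \int[mu]_(x in A) (F x * Num.max 0 (- h x))%:E].
Proof.
move=> mA mF mh F0 iFh.
have bnd (s : T -> R) : (forall x, `|s x| <= `|h x|)%R -> measurable_fun setT s ->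
    mu.-integrable A (EFin \o (fun x => F x * s x)%R).
  move=> sh ms; apply: (integrableS measurableT) => //.
  apply: le_integrable iFh => //.
    by apply/measurable_EFinP; exact: measurable_funM.
  by move=> x _ /=; rewrite lee_fin !normrM ler_wpM2l.
have ip : mu.-integrable A (EFin \o (fun x => F x * Num.max 0 (h x))%R).
  apply: bnd; last exact: measurable_maxr.
  by move=> x; rewrite ger0_norm ?le_max ?lexx// ge_max normr_ge0 ler_norm.
have iq : mu.-integrable A (EFin \o (fun x => F x * Num.max 0 (- h x))%R).
  apply: bnd; last by apply: measurable_maxr => //; exact: measurableT_comp.
  move=> x; rewrite ger0_norm ?le_max ?lexx// ge_max normr_ge0/=.
  by rewrite -normrN ler_norm.
split; [exact: integrable_fin_num|exact: integrable_fin_num|].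
rewrite -integralB_EFin//; apply: eq_integral => x _.
rewrite -EFinB; congr EFin; rewrite -mulrBr; congr (_ * _)%R.
have [h0|h0] := leP 0%R (h x); first by rewrite max_l ?subr0// oppr_le0.
by rewrite max_r ?sub0r ?opprK// oppr_ge0 ltW.
Qed.

End density.

(** * Averaging the kernel over the sample space *)

Section tonelli.
Local Open Scope ereal_scope.
Variables (R : realType) (d1 d2 : nat).
Variables (X : set 'rV[R]_d1) (lambda : {measure set 'rV[R]_d1 -> \bar R}).
Variable Theta : set 'rV[R]_d2.
Local Notation mu := (lebesgue_rV R d2).
Hypotheses (mX : measurable X) (sf_lambda : sigma_finite X lambda).

(** Tonelli's theorem asks for a measure that is sigma-finite on the whole space,
while [lambda] is only assumed so on [X]. *)
Definition restricted_measure := mrestr lambda mX.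

HB.instance Definition _ := Measure.on restricted_measure.

Let sigma_finite_restricted : sigma_finite setT restricted_measure.
Proof.
have [F XF Foo] := sf_lambda.
exists (fun n => F n `|` ~` X).
  apply/esym; rewrite -subTset => x _.
  have [Xx|Xx] := pselect (X x); last by exists 0%N => //; right.
  by have := Xx; rewrite {1}XF => -[n _ Fn]; exists n => //; left.
move=> n; have [mFn Fn] := Foo n; split.
  by apply: measurableU => //; exact: measurableC.
rewrite /restricted_measure /mrestr setIUl setICl setU0.
by rewrite (le_lt_trans _ Fn)// le_measure ?inE//; exact: measurableI.
Qed.

HB.instance Definition _ := Measure_isSigmaFinite.Build _ _ _
  restricted_measure sigma_finite_restricted.

Lemma integral_restricted (u : 'rV[R]_d1 -> \bar R) :
  (forall x, ~ X x -> u x = 0) ->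
  \int[restricted_measure]_x u x = \int[lambda]_(x in X) u x.
Proof.
move=> uX; transitivity (\int[restricted_measure]_(x in X) u x).
  rewrite [RHS]integral_mkcond; apply: eq_integral => x _.
  by rewrite patchE; case: ifPn => // /negP; rewrite inE => /uX.
apply: eq_measure_integral => A mA AX.
by rewrite /= /restricted_measure /mrestr setIidl.
Qed.

Variable f : 'rV[R]_d1 -> 'rV[R]_d2 -> R.
Hypotheses (mTheta : measurable Theta) (kernel_f : is_kernel X lambda Theta f).

Lemma measurable_kernel_section x : X x ->
  measurable_fun setT (f x \_ Theta).
Proof.
move=> Xx; apply/(measurable_restrictT _ mTheta).
have [mf _ _] := kernel_f.
move=> _ A mA; have := mf (measurableX mX mTheta) A mA.
move=> /(measurable_xsection x); congr measurable.
by apply/seteqP; split => y; rewrite /xsection/= inE/= => -[];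
  [move=> [_ Ty] fA|move=> Ty fA]; split.
Qed.

Section mixing.
Variable s : 'rV[R]_d2 -> R.
Hypotheses (ms : measurable_fun setT s) (s0 : forall y, (0 <= s y)%R)
  (sT : forall y, ~ Theta y -> s y = 0%R).

Let u := (fun p => (f p.1 p.2 * s p.2)%:E) \_ (X `*` Theta).

Let measurable_u : measurable_fun setT u.
Proof.
have [mf _ _] := kernel_f.
apply/(measurable_restrictT _ (measurableX mX mTheta))/measurable_EFinP.
apply: measurable_funM => //; apply: measurable_funTS.
exact: measurableT_comp.
Qed.

Let u_ge0 p : 0 <= u p.
Proof.
have [_ f0 _] := kernel_f; apply: erestrict_ge0 => -[x y] [/= Xx Ty].
by rewrite lee_fin mulr_ge0// f0.
Qed.

Let uE x y : X x -> u (x, y) = ((f x \_ Theta) y * s y)%:E.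
Proof.
move=> Xx; rewrite /u !patchE; case: ifPn => xy; case: ifPn => Ty//.
- by move: xy Ty; rewrite !inE => -[_ /= ?] /negP; rewrite inE.
- by move: xy Ty; rewrite !inE => /negP; rewrite inE => xy Ty; case: xy.
- by rewrite mul0r.
Qed.

Lemma measurable_mixture_kernel :
  measurable_fun X (fun x => \int[mu]_y ((f x \_ Theta) y * s y)%:E).
Proof.
have : measurable_fun setT (fubini_F mu u).
  exact: measurable_fun_fubini_tonelli_F.
move=> /measurable_funTS; move=> /(_ X); apply: eq_measurable_fun => x.
rewrite inE => Xx.
by apply: eq_integral => y _; exact: uE.
Qed.

(** By Tonelli's theorem, since each [f _ y] has total mass 1. *)
Lemma integral_mixture_kernel :
  \int[lambda]_(x in X) \int[mu]_y ((f x \_ Theta) y * s y)%:E =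
  \int[mu]_y (s y)%:E.
Proof.
have [mf f0 f1] := kernel_f; have mXT := measurableX mX mTheta.
have := @fubini_tonelli _ _ _ _ _ restricted_measure mu _ measurable_u u_ge0.
have uX x y : ~ X x -> u (x, y) = 0.
  by move=> Xx; rewrite /u patchE memNset// => -[].
have uT x y : ~ Theta y -> u (x, y) = 0.
  by move=> Ty; rewrite /u patchE memNset// => -[].
rewrite integral_restricted; last first.
  by move=> x Xx; apply: integral0_eq => y _; exact: uX.
move=> E; transitivity (\int[lambda]_(x in X) \int[mu]_y u (x, y)).
  apply: eq_integral => x; rewrite inE => Xx.
  by apply: eq_integral => y _; rewrite uE.
rewrite E; apply: eq_integral => y _.
rewrite integral_restricted; last by move=> x; exact: uX.
have [Ty|Ty] := pselect (Theta y); last first.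
  by rewrite sT//; apply: integral0_eq => x _; exact: uT.
transitivity (\int[lambda]_(x in X) ((s y)%:E * (f x y)%:E)).
  apply: eq_integral => x; rewrite inE => Xx.
  by rewrite uE// patchE mem_set// -EFinM mulrC.
rewrite ge0_integralZl_EFin// ?f1 ?mule1//.
  by move=> x Xx; rewrite lee_fin f0.
apply/measurable_EFinP.
move=> _ A mA; have := mf mXT A mA.
move=> /(measurable_ysection y); congr measurable.
by apply/seteqP; split => x; rewrite /ysection/= inE/= => -[];
  [move=> [Xx _] fA|move=> Xx fA]; split.
Qed.

End mixing.

End tonelli.

(** * Perturbing the mixing density *)

Section perturbed_density.
Local Open Scope ereal_scope.
Context d (T : measurableType d) (R : realType).
Variable mu : {sigma_finite_measure set T -> \bar R}.
Variables g h : T -> R.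
Hypotheses (mg : measurable_fun setT g) (g0 : forall x, (0 <= g x)%R)
  (mh : measurable_fun setT h) (hg : {ae mu, forall x, (- h x <= g x)%R}).

(** The positive part only matters on a null set; it makes the density nonnegative
everywhere. *)
Definition perturbed x : R := (Num.max 0 (g x + h x))%R.

Lemma measurable_perturbed : measurable_fun setT perturbed.
Proof. by apply: measurable_maxr => //; exact: measurable_funD. Qed.

Lemma perturbed_ge0 x : (0 <= perturbed x)%R.
Proof. by rewrite le_max lexx. Qed.

(** With [h = p - q], the densities satisfy [perturbed + q = g + p] almost everywhere,
an identity between nonnegative functions that can be integrated even where
the integral of [F * g] is infinite; the integrals of [F * p] and [F * q] are
finite. *)
Lemma integral_perturbed (F : T -> R) (A : set T) : measurable A ->
  measurable_fun setT F -> (forall x, (0 <= F x)%R) ->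
  mu.-integrable setT (fun x => (F x * h x)%:E) ->
  \int[mu]_(x in A) (F x * perturbed x)%:E =
  \int[mu]_(x in A) (F x * g x)%:E + \int[mu]_(x in A) (F x * h x)%:E.
Proof.
move=> mA mF F0 iFh.
have [pfin qfin ->] := integral_posneg mA mF mh F0 iFh.
set P := \int[mu]_(x in A) _ in pfin *; set Q := \int[mu]_(x in A) _ in qfin *.
have mp : measurable_fun setT (fun x => Num.max (0 : R)%R (h x)).
    exact: measurable_maxr.
have mq : measurable_fun setT (fun x => Num.max (0 : R)%R (- h x)%R).
  by apply: measurable_maxr => //; exact: measurableT_comp.
have mE (s : T -> R) : measurable_fun setT s ->
    measurable_fun A (fun x => (F x * s x)%:E).
  move=> ms; apply: measurable_funTS; apply/measurable_EFinP.
  exact: measurable_funM.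
have E : \int[mu]_(x in A) (F x * perturbed x)%:E + Q =
         \int[mu]_(x in A) (F x * g x)%:E + P.
  have mk := measurable_perturbed.
  rewrite -!ge0_integralD//; try exact: mE; try by
    move=> x _; rewrite lee_fin mulr_ge0// ?perturbed_ge0// le_max lexx.
  apply: ge0_ae_eq_integral => //.
  - by apply: emeasurable_funD; exact: mE.
  - by apply: emeasurable_funD; exact: mE.
  - move=> x _; rewrite adde_ge0// lee_fin mulr_ge0// ?perturbed_ge0//.
    by rewrite le_max lexx.
  - move=> x _; rewrite adde_ge0// lee_fin mulr_ge0// ?perturbed_ge0//.
    by rewrite le_max lexx.
  apply: filterS hg => x ghx _; rewrite -!EFinD -!mulrDr; congr (_ * _)%:E%R.
  rewrite /perturbed max_r; last by rewrite -(opprK (h x)) subr_ge0.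
  have [h0|h0] := leP 0%R (h x); first by rewrite max_l ?addr0// oppr_le0.
  by rewrite max_r ?addrK ?addr0// oppr_ge0 ltW.
by rewrite addeA -E addeK.
Qed.

End perturbed_density.

Section perturbed_mixture.
Variables (R : realType) (d1 d2 : nat).
Variables (X : set 'rV[R]_d1) (lambda : {measure set 'rV[R]_d1 -> \bar R}).
Variables (Theta : set 'rV[R]_d2) (f : 'rV[R]_d1 -> 'rV[R]_d2 -> R).
Local Notation mu := (lebesgue_rV R d2).
Hypotheses (mX : measurable X) (sf_lambda : sigma_finite X lambda)
  (mTheta : measurable Theta) (kernel_f : is_kernel X lambda Theta f).

Lemma mixture_density (G : probability 'rV[R]_d2 R) (g : 'rV[R]_d2 -> R) x :
  measurable_fun setT g -> (forall y, 0 <= g y) ->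
  (forall A, measurable A -> G A = (\int[mu]_(y in A) (g y)%:E)%E) ->
  X x -> mixture Theta f G x = (\int[mu]_y ((f x \_ Theta) y * g y)%:E)%E.
Proof.
move=> mg g0 Gg Xx; rewrite -(integral_density mg g0 Gg); first last.
- by apply: restrict_ge0 => y Ty; have [_ + _] := kernel_f; exact.
- exact: (measurable_kernel_section mX mTheta kernel_f).
rewrite /mixture integral_mkcond; apply: eq_integral => y _.
by rewrite /= !patchE; case: ifP.
Qed.

(** Extending the density by 0 lets all integrals run over the whole space. *)
Lemma density_patch (G : probability 'rV[R]_d2 R) (g : 'rV[R]_d2 -> R) :
  prob_on Theta G -> is_density Theta G g ->
  [/\ measurable_fun setT (g \_ Theta), forall y, 0 <= (g \_ Theta) y &
   forall A, measurable A -> G A = (\int[mu]_(y in A) ((g \_ Theta) y)%:E)%E].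
Proof.
move=> G1 [mg g0 Gg]; split; first exact/(measurable_restrictT _ mTheta).
  by apply: restrict_ge0.
move=> A mA; have GA : G A = G (A `&` Theta).
  have AE : A = A `&` Theta `|` A `&` ~` Theta.
    by rewrite -setIUr setUv setIT.
  have mAC : measurable (A `&` ~` Theta).
    by apply: measurableI => //; exact: measurableC.
  rewrite {1}AE measureU//; [|exact: measurableI|]; last first.
    by rewrite setIACA setICr setI0.
  rewrite -[RHS]adde0; congr (_ + _)%E.
  apply: (@subset_measure0 _ _ _ G _ (~` Theta)) => //.
    exact: measurableC.
  transitivity (1 - G Theta)%E; first exact: probability_setC.
  by rewrite (G1 : G Theta = 1%E) subee.
rewrite GA Gg//; last exact: measurableI.
rewrite integral_mkcondr; apply: eq_integral => y _.
by rewrite !patchE; case: ifP.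
Qed.

(** Orthogonality of [h] to the kernel forces [h] to have integral zero, because
averaging the kernel over the sample space gives the constant 1.  So the perturbed
density is again a probability density, and it has the same mixture. *)
Lemma perturbed_mixture (Gstar : probability 'rV[R]_d2 R)
    (gstar h : 'rV[R]_d2 -> R) :
  prob_on Theta Gstar -> is_density Theta Gstar gstar ->
  measurable_fun setT h -> mu.-integrable setT (EFin \o h) ->
  (forall y, ~ Theta y -> h y = 0) ->
  {ae mu, forall y, - h y <= (gstar \_ Theta) y} ->
  {ae lambda, forall x, X x ->
    mu.-integrable setT (fun y => ((f x \_ Theta) y * h y)%:E) /\
    (\int[mu]_y ((f x \_ Theta) y * h y)%:E = 0)%E} ->
  (exists2 A, measurable A & (\int[mu]_(y in A) (h y)%:E <> 0)%E) ->
  exists G : probability 'rV[R]_d2 R,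
    [/\ prob_on Theta G, exists2 A, measurable A & G A <> Gstar A &
        {ae lambda, forall x, X x ->
           mixture Theta f G x = mixture Theta f Gstar x}].
Proof.
move=> Gs1 Gsd mh ih hT hg fh [A mA hA].
have [mg g0 Gg] := density_patch Gs1 Gsd; set g := gstar \_ Theta in mg g0 Gg hg.
have [_ f0 _] := kernel_f.
have F0 x : X x -> forall y, 0 <= (f x \_ Theta) y.
  by move=> Xx; apply: restrict_ge0 => y; exact: f0.
have mF x : X x -> measurable_fun setT (f x \_ Theta).
  exact: (measurable_kernel_section mX mTheta kernel_f).
have i1h : mu.-integrable setT (fun y => (1 * h y)%:E).
  by apply: eq_integrable ih => // y _; rewrite mul1r.
have one (s : 'rV[R]_d2 -> R) B :
    (\int[mu]_(y in B) (cst 1 y * s y)%:E = \int[mu]_(y in B) (s y)%:E)%E.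
  by apply: eq_integral => y _; rewrite mul1r.
pose p y := Num.max 0 (h y); pose q y := Num.max 0 (- h y).
have posneg1 : [/\ (\int[mu]_y (p y)%:E \is a fin_num)%E,
    (\int[mu]_y (q y)%:E \is a fin_num)%E &
    (\int[mu]_y (h y)%:E = \int[mu]_y (p y)%:E - \int[mu]_y (q y)%:E)%E].
  have := integral_posneg measurableT (measurable_cst (1 : R)) mh (fun=> ler01) i1h.
  by rewrite (one p) (one q) (one h).
pose k := perturbed g h.
have mk : measurable_fun setT k := measurable_perturbed mg mh.
have k0 y : 0 <= k y by exact: perturbed_ge0.
have intk B : measurable B -> (\int[mu]_(y in B) (k y)%:E =
    Gstar B + \int[mu]_(y in B) (h y)%:E)%E.
  move=> mB; have := integral_perturbed mg g0 mh hg mB (measurable_cst (1 : R))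
    (fun=> ler01) i1h.
  by rewrite (one k) (one g) (one h) -Gg.
have h0 : (\int[mu]_y (h y)%:E = 0)%E.
  have [pfin qfin ->] := posneg1.
  suff -> : (\int[mu]_y (p y)%:E = \int[mu]_y (q y)%:E)%E by rewrite subee.
  have mp : measurable_fun setT p by exact: measurable_maxr.
  have mq : measurable_fun setT q.
    by apply: measurable_maxr => //; exact: measurableT_comp.
  have p0 y : 0 <= p y by rewrite le_max lexx.
  have q0 y : 0 <= q y by rewrite le_max lexx.
  have pT y : ~ Theta y -> p y = 0 by move=> /hT hy; rewrite /p hy maxxx.
  have qT y : ~ Theta y -> q y = 0.
    by move=> /hT hy; rewrite /q hy oppr0 maxxx.
  rewrite -(integral_mixture_kernel mX sf_lambda mTheta kernel_f mp p0 pT).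
  rewrite -(integral_mixture_kernel mX sf_lambda mTheta kernel_f mq q0 qT).
  apply: ge0_ae_eq_integral => //.
  - exact: (measurable_mixture_kernel mX mTheta kernel_f mp p0).
  - exact: (measurable_mixture_kernel mX mTheta kernel_f mq q0).
  - move=> x Xx; apply: integral_ge0 => y _; rewrite lee_fin.
    exact: mulr_ge0 (F0 x Xx y) (p0 y).
  - move=> x Xx; apply: integral_ge0 => y _; rewrite lee_fin.
    exact: mulr_ge0 (F0 x Xx y) (q0 y).
  apply: filterS fh => x fhx Xx; have [ifh] := fhx Xx.
  have [pfin' qfin' ->] := integral_posneg measurableT (mF x Xx) mh (F0 x Xx) ifh.
  by move=> /eqP; rewrite sube_eq ?fin_num_adde_defr// add0e => /eqP.
have k1 : (\int[mu]_y (k y)%:E = 1)%E.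
  by rewrite intk// h0 adde0 probability_setT.
have [G Gk] := exists_probability_density mk k0 k1.
exists G; split.
- rewrite /prob_on Gk// intk// Gs1 (_ : integral _ _ _ = 0%E) ?adde0//.
  rewrite -h0 [LHS]integral_mkcond; apply: eq_integral => y _.
  by rewrite patchE; case: ifPn => // /negP; rewrite inE => /hT ->.
- exists A => // GA; apply: hA.
  have Gfin : Gstar A \is a fin_num by exact: fin_num_measure.
  move: GA; rewrite Gk// intk// addeC => GA.
  by rewrite -[LHS](addeK _ Gfin) GA subee.
- apply: filterS fh => x fhx Xx; have [ifh fh0] := fhx Xx.
  rewrite (mixture_density mk k0 Gk Xx) (mixture_density mg g0 Gg Xx).
  rewrite (integral_perturbed mg g0 mh hg measurableT (mF x Xx) (F0 x Xx) ifh).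
  by rewrite fh0 adde0.
Qed.

End perturbed_mixture.

(** * Non-identifiability of the mixing measure *)

Theorem theorem2 (R : realType) (d1 d2 : nat)
    (X : set 'rV[R]_d1) (lambda : {measure set 'rV[R]_d1 -> \bar R})
    (Theta : set 'rV[R]_d2) (f : 'rV[R]_d1 -> 'rV[R]_d2 -> R)
    (L : ddop R d2) (U : set 'rV[R]_d2) (theta0 : 'rV[R]_d2) (rho : R)
    (Gstar : probability 'rV[R]_d2 R) (gstar : 'rV[R]_d2 -> R) (m : R)
    (mX : measurable X) (sf_lambda : sigma_finite X lambda)
    (compactTheta : compact Theta) (Theta_reg : Theta = closure Theta°)
    (Theta_int : Theta° !=set0)
    (kernel_f : is_kernel X lambda Theta f)
    (ddopL : is_ddop Theta U L)
    (pde_f : shift_parameter_pde X lambda U L f)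
    (rho_gt0 : 0 < rho)
    (ballU : eball theta0 rho `<=` U)
    (ball_shift : forall j : 'I_(nshift L).+1,
       closure (translate (eball theta0 rho) (shift_vec L j)) `<=` Theta°)
    (rho_small : forall i j : 'I_(nshift L).+1, i != j ->
       rho < 2^-1 * enorm (shift_vec L i - shift_vec L j))
    (nontrivialL : nontrivial_on (eball theta0 rho) L)
    (Gstar_prob : prob_on Theta Gstar)
    (gstar_density : is_density Theta Gstar gstar)
    (m_gt0 : 0 < m)
    (gstar_ge : {ae lebesgue_rV R d2, forall theta,
       shifted_union L (eball theta0 rho) theta -> m <= gstar theta}) :
  exists G : probability 'rV[R]_d2 R,
    [/\ prob_on Theta G,
        (* as measures, i.e. on Borel sets *)
        exists2 A, measurable A & G A <> Gstar A &
        {ae lambda, forall x, X x ->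
           mixture Theta f G x = mixture Theta f Gstar x}].
Proof.
set B := eball theta0 rho.
have oB : open B by exact: open_eball.
have mTheta : measurable Theta by exact: measurable_compact.
have [_ [_ _] _ CU] := ddopL.
have Ccoeff j (a : 'I_d2 -> nat) : (mdegree a <= Defs.order L j)%N ->
    Ck (mdegree a) B (coeff L j a).
  by move=> aj; apply: Ck_sub ballU _; exact: CU.
have disj i j (x : 'rV[R]_d2) : i != j -> translate B (shift_vec L i) x ->
    translate B (shift_vec L j) x -> False.
  by move=> ij; exact: eball_translate_disjoint (rho_small _ _ ij).
have [phi [K [cK KB Cphi phiK [x0 hx0]]]] :=
  exists_nonzero_adjoint oB Ccoeff disj nontrivialL.
have KBU : shifted_union L K `<=` shifted_union L B.
  by move=> x [j _ Kx]; exists j => //; exact: sub_translate Kx.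
have BTheta : shifted_union L B `<=` Theta.
  move=> x [j _ Bx]; apply: interior_subset; apply: (ball_shift j).
  exact: subset_closure.
pose h := adjoint L phi.
have hK x : ~ shifted_union L K x -> h x = 0 by exact: adjoint_off.
have hT x : ~ Theta x -> h x = 0.
  by move=> Tx; apply: hK => /KBU/BTheta.
have Cch : Cc h by exact: (adjoint_Cc oB cK KB Cphi phiK Ccoeff).
have [C hC] := Cc_bounded Cch.
have C1_gt0 : 0 < `|C| + 1 by rewrite ltr_wpDl.
(* The 1 in the denominator keeps it positive, and makes [e * h] at most [m]. *)
pose e := m / (`|C| + 1); have e0 : 0 < e by rewrite divr_gt0.
pose eta x := e * h x.
have Cceta : Cc eta by exact: CcZ.
have eta_le x : `|eta x| <= m.
  rewrite normrM gtr0_norm// /e mulrAC ler_pdivrMr//.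
  apply: ler_wpM2l; first exact: ltW.
  by rewrite (le_trans (hC x))// (le_trans (ler_norm _))// lerDl.
apply: (@perturbed_mixture _ _ _ X lambda Theta f mX sf_lambda mTheta kernel_f
  Gstar gstar eta) => //.
- exact: continuous_measurable Cceta.1.
- exact: Cc_integrable.
- by move=> y Ty; rewrite /eta hT// mulr0.
- apply: filterS gstar_ge => y my.
  have [By|By] := pselect (shifted_union L B y).
    rewrite patchE mem_set; last exact: BTheta.
    apply: le_trans (my By); apply: le_trans (eta_le y).
    by rewrite -normrN ler_norm.
  rewrite /eta hK ?mulr0 ?oppr0; last by move=> /KBU.
  by apply: restrict_ge0; case: gstar_density.
- apply: filterS pde_f => x fx Xx; have [Cf Lf] := fx Xx.
  have CfB : Ck (max_order L) (shifted_union L B) (f x).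
    apply: Ck_sub Cf => y [j _ By]; exists j => //.
    exact: sub_translate By.
  have [Ccf _ hf] := adjoint_duality oB cK KB Cphi phiK Ccoeff CfB.
  have fE : (fun y => (f x \_ Theta) y * eta y) = (fun y => e * (h y * f x y)).
    apply/funext => y; rewrite /eta patchE; case: ifPn => [_|/negP].
      by rewrite mulrCA [f x y * _]mulrC.
    by rewrite inE => Ty; rewrite hT// !(mulr0, mul0r).
  have Ccfe : Cc (fun y => (f x \_ Theta) y * eta y) by rewrite fE; exact: CcZ.
  have ife := Cc_integrable Ccfe; split=> //.
  rewrite -[LHS]fineK; last exact: integrable_fin_num.
  congr EFin; rewrite -[LHS]/(\int[lebesgue_rV R d2]_y _) fE.
  rewrite RintegralZl//; last exact: Cc_integrable.
  rewrite hf /Rintegral (eq_integral (cst 0%E)) ?integral0 ?mulr0// => y _.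
  have [Ky|Ky] := pselect (K y); last by rewrite phiK// mul0r.
  by rewrite Lf ?mulr0//; exact/ballU/KB.
(* [A] below is the open set where [h] has the sign of [h x0]; the integral of
   [s * h] over it is that of the nonnegative function [r]. *)
pose s := h x0; pose r y := Num.max 0 (s * h y).
have cs : continuous (fun y => s * h y) := (CcZ s Cch).1.
have Ccr : Cc r.
  split.
    move=> y; apply: (@continuous_max _ _ (fun=> 0) (fun y => s * h y) y).
      exact: cst_continuous.
    exact: cs.
  have [_ [K' cK' hK']] := Cch; exists K' => // y Ky.
  by rewrite /r hK'// mulr0 maxxx.
have r_gt0 : 0 < \int[lebesgue_rV R d2]_y r y.
  apply: (@Rint_gt0 _ _ _ x0) => // [y|]; first by rewrite le_max lexx.
  by rewrite lt_max; apply/orP; right; rewrite -expr2 exprn_even_gt0.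
pose A := [set y | 0 < s * h y].
have mA : measurable A.
  apply: measurable_open.
  rewrite (_ : A = (fun y => s * h y) @^-1` [set t | 0 < t])//.
  by apply: open_comp => [y _|]; [exact: cs|exact: open_gt].
exists A => // A0.
have ieA : (lebesgue_rV R d2).-integrable A (EFin \o eta).
  by apply: (integrableS measurableT) => //; exact: Cc_integrable.
have : \int[lebesgue_rV R d2]_(y in A) (s * eta y) =
    e * \int[lebesgue_rV R d2]_y r y.
  rewrite -RintegralZl//; last exact: Cc_integrable.
  rewrite Rintegral_mkcond; apply: eq_Rintegral => y _.
  rewrite patchE /r /eta; case: ifPn => [|/negP]; rewrite inE /A/= => sy.
    by rewrite max_r ?ltW// mulrCA.
  by rewrite max_l ?mulr0// leNgt; exact/negP.
rewrite RintegralZl// /Rintegral A0 mulr0 => /esym/eqP.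
by rewrite mulf_eq0 !gt_eqF.
Qed.
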